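(* Let $H$ be a complex Hilbert space, let $A,B\in B^{++}(H)$, $n\in\mathbb{N}$ (so $n\ge1$) and $v\in\mathbb{R}$. (i) If $v\notin\left[0,\frac1{2^n}\right]$, then $$A\nabla_v B\le A\natural_v B+v\sum_{k=1}^n 2^{k-1}\left(A-2\,A\sharp_{\frac1{2^k}}B+A\sharp_{\frac1{2^{k-1}}}B\right).$$ (ii) If $v\notin\left[\frac{2^n-1}{2^n},1\right]$, then $$A\nabla_v B\le A\natural_v B+(1-v)\sum_{k=1}^n 2^{k-1}\left(B-2\,A\sharp_{\frac{2^k-1}{2^k}}B+A\sharp_{\frac{2^{k-1}-1}{2^{k-1}}}B\right).$$
   Context: $B(H)$ is the algebra of bounded linear operators on the complex Hilbert space $H$. A self-adjoint $T\in B(H)$ is positive, written $T\ge0$, if $\langle Tx,x\rangle\ge0$ for all $x\in H$; $S\le T$ means $T-S\ge0$. $B^{++}(H)$ is the set of positive invertible operators in $B(H)$. For $A,B\in B^{++}(H)$ and $v\in\mathbb{R}$, set $A\nabla_v B=(1-v)A+vB$ and $A\natural_v B=A^{1/2}\left(A^{-1/2}BA^{-1/2}\right)^vA^{1/2}$ (real powers via continuous functional calculus). For $v\in[0,1]$ the operator $A\natural_v B$ is written $A\sharp_v B$. *)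

(* Defs.v *)
From HB Require Import structures.
From mathcomp Require Import all_boot all_order all_algebra.
From mathcomp Require Import all_classical all_reals all_analysis.
From mathcomp Require Import complex.

Set Implicit Arguments.
Unset Strict Implicit.
Unset Printing Implicit Defensive.

Import Order.TTheory GRing.Theory Num.Theory.
Import numFieldNormedType.Exports.

Local Open Scope classical_set_scope.
Local Open Scope ring_scope.
Local Open Scope complex_scope.

(* The inner product is linear in its first argument and conjugate-linear in
   its second one. *)
HB.mixin Record CompleteNormedModule_isHilbert (R : realType) H
    & CompleteNormedModule R[i] H := {
  inner : {dot H for @Num.conj R[i]} ;
  sqr_norm_inner : forall x : H, `|x| ^+ 2 = inner x x
}.

#[short(type="hilbertType")]
HB.structure Definition Hilbert (R : realType) :=
  {H of CompleteNormedModule_isHilbert R H & CompleteNormedModule R[i] H}.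

Section Operators.
Context {R : realType} {H : hilbertType R}.
Implicit Types S T A B : H -> H.

(* B(H), as a subset of the R[i]-module H -> H of all maps. *)
Definition bounded_operator : set (H -> H) :=
  [set T | linear T /\ exists M : R, forall x, `|T x| <= M%:C * `|x|].

Definition self_adjoint : set (H -> H) :=
  [set T | bounded_operator T /\
           forall x y : H, inner (T x) y = inner x (T y)].

(* [0 <= z] in R[i] means that z is real and nonnegative. *)
Definition positive_operator : set (H -> H) :=
  [set T | self_adjoint T /\ forall x : H, 0 <= inner (T x) x].

Definition ole S T : Prop := positive_operator (T - S).

Definition invertible_operator : set (H -> H) :=
  [set T | bounded_operator T /\
           exists2 S, bounded_operator S & S \o T = id /\ T \o S = id].

Definition positive_invertible : set (H -> H) :=
  positive_operator `&` invertible_operator.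

Definition spectrum T : set R[i] :=
  [set z | ~ invertible_operator (T - z *: id)].

Definition poly_operator (p : {poly R}) T : H -> H :=
  \sum_(i < size p) (p`_i)%:C *: iter i T.

(* For a self-adjoint T, whose spectrum is real, and f continuous on it, f(T)
   is the norm limit of p_n(T) for any real polynomials p_n converging to f
   uniformly on the spectrum.  Convergence in operator norm is uniform
   convergence on the closed unit ball. *)
Definition is_functional_calculus (f : R -> R) T S : Prop :=
  bounded_operator S /\
  exists p : nat -> {poly R},
    {uniform [set t : R | spectrum T t%:C],
       (fun n (t : R) => (p n).[t]) @ \oo --> f} /\
    {uniform [set x : H | `|x| <= 1],
       (fun n => poly_operator (p n) T) @ \oo --> S}.

Definition functional_calculus (f : R -> R) T : H -> H :=
  xget 0 [set S | is_functional_calculus f T S].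

Definition opower T (v : R) : H -> H :=
  functional_calculus (fun t : R => t `^ v) T.

Definition arith_mean A B (v : R) : H -> H := (1 - v)%:C *: A + v%:C *: B.

Definition geo_mean A B (v : R) : H -> H :=
  opower A 2^-1 \o
  opower (opower A (- 2^-1) \o B \o opower A (- 2^-1)) v \o
  opower A 2^-1.

End Operators.

Notation "S <=op T" := (ole S T) (at level 70, no associativity).
Notation "A ∇_[ v ] B" := (arith_mean A B v)
  (at level 49, v at level 200, format "A  ∇_[ v ]  B").
Notation "A ♮_[ v ] B" := (geo_mean A B v)
  (at level 49, v at level 200, format "A  ♮_[ v ]  B").

(* The same operator as ♮, this symbol being used for v in [0, 1]. *)
Notation "A ♯_[ v ] B" := (geo_mean A B v)
  (at level 49, v at level 200, only parsing).

(* Main.v *)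
Require Import Defs.
From mathcomp Require Import all_boot all_order all_algebra.
From mathcomp Require Import all_classical all_reals all_analysis.
From mathcomp Require Import complex.
From mathcomp Require Import ring lra.

(** The proof reduces the operator inequality to a scalar one by a congruence.

    Put X = A^(1/2), Y = A^(-1/2) and C = Y B Y, which is positive and
    invertible.  Then A = X 1 X, B = X C X and the mean of weight w is
    X C^w X, so that right-hand side minus left-hand side is X f(C) X for an
    explicit real function f.  It remains to see that f >= 0 on the spectrum
    of C, which lies in some [a, b] with a > 0.

    For (i) and t > 0, the sum over k telescopes to
    2^n - 1 + t - 2^n t^(1/2^n) ([dyadic_telescope]), and with s = t^(1/2^n)
    and w = 2^n v the inequality f(t) >= 0 becomes Bernoulli's inequality
    1 + w (s - 1) <= s^w, valid for w outside [0, 1] ([bernoulli_powR]).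
    Part (ii) is part (i) for 1/t and 1 - v, multiplied by t.

    The passage from f >= 0 to f(C) >= 0 is the spectral theory of a
    self-adjoint T, reduced to what this needs:
    - a self-adjoint operator bounded below by c > 0 is invertible, since an
      iteration solving T x = y is a contraction ([coercive_invertible]);
    - hence the infimum of the quadratic form of a self-adjoint operator belongs
      to its spectrum ([spectrum_meets_numerical_range]);
    - a real polynomial p which is nonnegative on the real spectrum of T gives
      p(T) >= 0 ([poly_operator_ge0]): otherwise that infimum m, taken for
      p(T), is negative, p(T) - m is not invertible, and one of the linear
      factors T - z of p(T) - m is not invertible; z is real, and
      p(z) = m < 0.
    Applied to e^2 - p^2, the last point bounds the norm of p(T) by the supremum
    of |p| on the spectrum ([poly_operator_norm_le]).  Therefore f(T) is
    unique, additive, multiplicative and monotone in f, and it exists as soon as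
    f is a uniform limit of polynomials on the spectrum.  The powers t^v are
    such limits because they are Lipschitz on [a, b] and Bernstein polynomials
    approximate Lipschitz functions ([lipschitz_poly_approx]). *)

Set Implicit Arguments.
Unset Strict Implicit.
Unset Printing Implicit Defensive.
Import Order.TTheory GRing.Theory Num.Theory.
Import numFieldNormedType.Exports.
Local Open Scope classical_set_scope.
Local Open Scope ring_scope.
Local Open Scope complex_scope.

(** * The real inner product Re <x, y> and the classes of operators *)

Lemma ReD (R : rcfType) (a b : R[i]) :
  complex.Re (a + b) = complex.Re a + complex.Re b.
Proof. by case: a => ? ?; case: b. Qed.

Lemma ReN (R : rcfType) (a : R[i]) : complex.Re (- a) = - complex.Re a.
Proof. by case: a. Qed.

Lemma ReZ (R : rcfType) (k : R) (a : R[i]) :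
  complex.Re (k%:C * a) = k * complex.Re a.
Proof. by case: a => ? ? /=; rewrite mul0r subr0. Qed.

Section RealInnerProduct.
Context {R : realType} {H : hilbertType R}.
Implicit Types x y z : H.

Definition rinner x y : R := complex.Re (inner x y).
Definition rnorm x : R := complex.Re `|x|.

Lemma rnormE x : `|x| = (rnorm x)%:C.
Proof. by rewrite /rnorm RRe_real // normr_real. Qed.

Lemma rnorm_ge0 x : 0 <= rnorm x.
Proof. by rewrite -lecR -rnormE normr_ge0. Qed.

Lemma rnorm0 : rnorm 0 = 0.
Proof. by rewrite /rnorm normr0. Qed.

Lemma rnorm0_eq0 x : rnorm x = 0 -> x = 0.
Proof. by move=> x0; apply/eqP; rewrite -normr_eq0 rnormE x0. Qed.

Lemma ler_rnormD x y : rnorm (x + y) <= rnorm x + rnorm y.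
Proof. by rewrite -lecR rmorphD /= -!rnormE ler_normD. Qed.

Lemma rnormZ (a : R) x : rnorm (a%:C *: x) = `|a| * rnorm x.
Proof.
apply: complexI; rewrite -rnormE normrZ rmorphM /= -rnormE; congr (_ * _).
by rewrite normc_def /= expr0n addr0 sqrtr_sqr.
Qed.

Lemma rnormN x : rnorm (- x) = rnorm x.
Proof. by rewrite /rnorm normrN. Qed.

Lemma rinnerC x y : rinner x y = rinner y x.
Proof.
rewrite /rinner hermC expr0 mul1r.
by rewrite -[LHS]/(complex.Re (inner y x)^*%C); case: (inner y x).
Qed.

Lemma rinnerDl x y z : rinner (x + y) z = rinner x z + rinner y z.
Proof. by rewrite /rinner linearDl ReD. Qed.

Lemma rinnerDr x y z : rinner z (x + y) = rinner z x + rinner z y.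
Proof. by rewrite rinnerC rinnerDl !(rinnerC z). Qed.

Lemma rinnerZl (a : R) x y : rinner (a%:C *: x) y = a * rinner x y.
Proof. by rewrite /rinner linearZl_LR ReZ. Qed.

Lemma rinnerZr (a : R) x y : rinner x (a%:C *: y) = a * rinner x y.
Proof. by rewrite rinnerC rinnerZl rinnerC. Qed.

Lemma rinnerNl x y : rinner (- x) y = - rinner x y.
Proof. by rewrite /rinner linearNl ReN. Qed.

Lemma rinnerNr x y : rinner x (- y) = - rinner x y.
Proof. by rewrite rinnerC rinnerNl rinnerC. Qed.

Lemma rinnerBl x y z : rinner (x - y) z = rinner x z - rinner y z.
Proof. by rewrite rinnerDl rinnerNl. Qed.

Lemma rinnerBr x y z : rinner z (x - y) = rinner z x - rinner z y.
Proof. by rewrite rinnerDr rinnerNr. Qed.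

Lemma rinner_sq x : rinner x x = rnorm x ^+ 2.
Proof. by rewrite /rinner -sqr_norm_inner rnormE -rmorphXn. Qed.


Lemma rinner0l x : rinner 0 x = 0.
Proof. by rewrite /rinner linear0l. Qed.

Lemma rinner0r x : rinner x 0 = 0.
Proof. by rewrite rinnerC rinner0l. Qed.

Lemma rinner_le x y : rinner x y <= rnorm x * rnorm y.
Proof.
have [/eqP y0|y0] := boolP (rnorm y == 0).
  by rewrite (rnorm0_eq0 y0) rinner0r rnorm0 mulr0.
have [/eqP x0|x0] := boolP (rnorm x == 0).
  by rewrite (rnorm0_eq0 x0) rinner0l rnorm0 mul0r.
have xp : 0 < rnorm x by rewrite lt_def x0 rnorm_ge0.
have yp : 0 < rnorm y by rewrite lt_def y0 rnorm_ge0.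
have := rinner_sq ((rnorm y)%:C *: x - (rnorm x)%:C *: y).
rewrite !(rinnerBl, rinnerBr, rinnerZl, rinnerZr) !rinner_sq (rinnerC y x).
set c := rinner x y; set d := rnorm (_ - _) => e; have d0 := sqr_ge0 d.
rewrite -(ler_pM2l (mulr_gt0 xp yp)); move: e d0 => <-; lra.
Qed.

Lemma rinner_ge x y : - (rnorm x * rnorm y) <= rinner x y.
Proof. by rewrite lerNl -rinnerNl -(rnormN x) rinner_le. Qed.

(** Every identity about the complex form follows from one about its real
    part, the imaginary part being a real part too. *)
Lemma Im_inner x y : complex.Im (inner x y) = rinner x ('i%C *: y).
Proof.
rewrite /rinner linearZr_LR /= -[RHS]/(complex.Re (('i%C : R[i])^*%C * inner x y)).
by case: (inner x y) => a b /=; rewrite !mul0r sub0r mulN1r opprK.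
Qed.

End RealInnerProduct.

Section OperatorClasses.
Context {R : realType} {H : hilbertType R}.
Implicit Types (S T : H -> H) (x y : H).

Lemma linear_opD T x y : linear T -> T (x + y) = T x + T y.
Proof. by move=> lT; have := lT 1 x y; rewrite !scale1r. Qed.

Lemma linear_op0 T : linear T -> T 0 = 0.
Proof.
by move=> lT; apply/(addrI (T 0)); rewrite -(linear_opD _ _ lT) !addr0.
Qed.

Lemma linear_opZ T (a : R[i]) x : linear T -> T (a *: x) = a *: T x.
Proof. by move=> lT; have := lT a x 0; rewrite (linear_op0 lT) !addr0. Qed.

Lemma linear_opN T x : linear T -> T (- x) = - T x.
Proof. by move=> lT; rewrite -scaleN1r (linear_opZ _ _ lT) scaleN1r. Qed.

Lemma linear_opB T x y : linear T -> T (x - y) = T x - T y.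
Proof. by move=> lT; rewrite (linear_opD _ _ lT) (linear_opN _ lT). Qed.

Lemma bounded_operatorP T : bounded_operator T <->
  linear T /\ exists2 M : R, 0 < M & forall x, rnorm (T x) <= M * rnorm x.
Proof.
split=> [[lT [M TM]]|[lT [M _ TM]]]; split=> //; last first.
  by exists M => x; rewrite !rnormE -rmorphM lecR.
exists (`|M| + 1) => [|x]; first by rewrite ltr_wpDl.
have := TM x; rewrite !rnormE -rmorphM lecR => /le_trans; apply.
by rewrite ler_wpM2r ?rnorm_ge0 // (le_trans (ler_norm M)) // lerDl.
Qed.

Lemma bounded_linear T : bounded_operator T -> linear T.
Proof. by case. Qed.

Lemma bounded_id : bounded_operator (@id H).
Proof.
apply/bounded_operatorP; split=> //; exists 1 => // x.
by rewrite mul1r.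
Qed.

Lemma bounded_comp S T :
  bounded_operator S -> bounded_operator T -> bounded_operator (S \o T).
Proof.
move=> /bounded_operatorP[lS [M M0 SM]] /bounded_operatorP[lT [N N0 TN]].
apply/bounded_operatorP; split=> [a u v|]; first by rewrite /= lT lS.
exists (M * N) => [|x]; first exact: mulr_gt0.
by rewrite (le_trans (SM _)) // -mulrA ler_wpM2l // ltW.
Qed.

Lemma bounded_add S T :
  bounded_operator S -> bounded_operator T -> bounded_operator (S + T).
Proof.
move=> /bounded_operatorP[lS [M M0 SM]] /bounded_operatorP[lT [N N0 TN]].
apply/bounded_operatorP; split=> [a u v|].
  by rewrite !fctE lS lT scalerDr addrACA.
exists (M + N) => [|x]; first exact: addr_gt0.
by rewrite (le_trans (ler_rnormD _ _)) // mulrDl lerD.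
Qed.

Lemma rnormZ_complex (a : R[i]) x :
  rnorm (a *: x) = complex.Re `|a| * rnorm x.
Proof.
by rewrite {1}/rnorm normrZ rnormE -(RRe_real (normr_real a)) ReZ.
Qed.

Lemma bounded_scale (a : R[i]) T :
  bounded_operator T -> bounded_operator (a *: T).
Proof.
move=> /bounded_operatorP[lT [M M0 TM]].
apply/bounded_operatorP; split=> [b u v|].
  by rewrite !fctE lT scalerDr !scalerA mulrC.
have a0 : 0 <= complex.Re `|a|.
  by rewrite -lecR RRe_real ?normr_ge0 ?normr_real.
exists ((complex.Re `|a| + 1) * M) => [|x]; first by rewrite mulr_gt0 // ltr_wpDl.
rewrite rnormZ_complex -mulrA ler_pM ?rnorm_ge0 //.
by rewrite lerDl.
Qed.

(** Symmetry of the real form suffices, as a linear operator commutes with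
    multiplication by i. *)
Lemma self_adjointP T : self_adjoint T <->
  bounded_operator T /\ forall x y, rinner (T x) y = rinner x (T y).
Proof.
split=> -[bT sT]; split=> // x y; first by rewrite /rinner sT.
have lT := bounded_linear bT.
apply/eqP; rewrite eq_complex; apply/andP; split; apply/eqP; first exact: sT.
by rewrite !Im_inner sT linear_opZ.
Qed.

(** Self-adjointness already makes the quadratic form real. *)
Lemma positive_operatorP T : positive_operator T <->
  self_adjoint T /\ forall x, 0 <= rinner (T x) x.
Proof.
split=> -[sT T0]; split=> // x; have := T0 x.
  by rewrite lecE => /andP[].
move=> Tx; rewrite lecE Tx andbT /=; apply/eqP.
have e : inner (T x) x = (inner (T x) x)^*%C.
  rewrite {2}sT.2; have := hermC (@inner R H) (T x) x.
  by rewrite expr0 mul1r; exact.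
move/(congr1 (@complex.Im R)): e; case: (inner (T x) x) => a b /= e; lra.
Qed.

Lemma self_adjoint_bounded T : self_adjoint T -> bounded_operator T.
Proof. by case. Qed.

Lemma self_adjoint_linear T : self_adjoint T -> linear T.
Proof. by case=> /bounded_linear. Qed.

Lemma self_adjoint_rinner T x y :
  self_adjoint T -> rinner (T x) y = rinner x (T y).
Proof. by move=> /self_adjointP[]. Qed.

Lemma self_adjoint_id : self_adjoint (@id H).
Proof. by split=> //; exact: bounded_id. Qed.

Lemma self_adjoint_add S T :
  self_adjoint S -> self_adjoint T -> self_adjoint (S + T).
Proof.
move=> /self_adjointP[bS sS] /self_adjointP[bT sT]; apply/self_adjointP.
split=> [|x y]; first exact: bounded_add.
by rewrite !fctE rinnerDl rinnerDr sS sT.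
Qed.

Lemma self_adjoint_scale (a : R) T :
  self_adjoint T -> self_adjoint (a%:C *: T).
Proof.
move=> /self_adjointP[bT sT]; apply/self_adjointP.
split=> [|x y]; first exact: bounded_scale.
by rewrite !fctE rinnerZl rinnerZr sT.
Qed.

Lemma self_adjoint_sub S T :
  self_adjoint S -> self_adjoint T -> self_adjoint (S - T).
Proof.
move=> sS sT; rewrite -scaleN1r; apply: self_adjoint_add => //.
by have := self_adjoint_scale (-1) sT; rewrite rmorphN1.
Qed.

Lemma self_adjoint_conj S T :
  self_adjoint S -> self_adjoint T -> self_adjoint (S \o T \o S).
Proof.
move=> sS sT; apply/self_adjointP; split=> [|x y].
  by apply: bounded_comp; [apply: bounded_comp|]; apply: self_adjoint_bounded.
by rewrite /= !self_adjoint_rinner.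
Qed.

End OperatorClasses.

(** * Uniform convergence and completeness in terms of the real norm *)

Lemma uniform_ballP (K : numFieldType) (U : choiceType)
    (V : pseudoMetricType K) (A : set U) (F : nat -> U -> V) (f : U -> V) :
  {uniform A, F @ \oo --> f} <->
  forall e : K, 0 < e -> exists N, forall n, (N <= n)%N ->
    forall x, A x -> ball (f x) e (F n x).
Proof.
split=> [Ff e e0|Ff].
  have : nbhs (f : {uniform` A -> V})
      [set h : {uniform` A -> V} | forall x, A x -> ball (f x) e (h x)].
    apply/uniform_nbhs; exists [set xy | ball xy.1 e xy.2]; split=> //.
    exact: entourage_ball (PosNum e0).
  by move=> /Ff[N _ NF]; exists N => n Nn; exact: NF.
move=> P /uniform_nbhs[E [+ EP]]; rewrite -entourage_ballE => -[e /= e0 eE].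
have [N NF] := Ff e e0; exists N => // n Nn; apply: EP => x Ax.
by apply: eE; exact: NF.
Qed.

Section Limits.
Context {R : realType} {H : hilbertType R}.

Lemma ball_rnorm (e : R) (x y : H) : ball x e%:C y = (rnorm (y - x) < e).
Proof.
by rewrite -ball_normE /= -ltcR -rnormE distrC.
Qed.

Lemma realC_gt0 (e : R[i]) : 0 < e -> exists2 r : R, 0 < r & e = r%:C.
Proof.
case: e => a b; rewrite ltcE /= => /andP[/eqP -> a0]; by exists a.
Qed.

Lemma rnorm_complete (u : nat -> H) :
  (forall e : R, 0 < e -> exists N, forall m n, (N <= m)%N -> (N <= n)%N ->
     rnorm (u m - u n) <= e) ->
  exists l : H, forall e : R, 0 < e -> exists N, forall n, (N <= n)%N ->
     rnorm (u n - l) <= e.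
Proof.
move=> cu; have /cauchy_cvgP : cauchy (u @ \oo).
  apply/cauchy_ballP => _ /realC_gt0[e e0 ->]. near_simpl.
  have [|N uN] := cu (e / 2); first by rewrite divr_gt0.
  exists ([set n | (N <= n)%N] , [set n | (N <= n)%N]); first by split; exists N.
  move=> [m n] [/= Nm Nn]; rewrite ball_rnorm.
  by rewrite (le_lt_trans (uN _ _ Nn Nm)) // ltr_pdivrMr // mulr2n; lra.
move=> /cvg_ex[l /cvg_ballP ul]; exists l => e e0.
have [|N _ uN] := ul e%:C; first by rewrite ltcR.
by exists N => n /uN /=; rewrite ball_rnorm => /ltW.
Qed.

Lemma uniform_realP (A : set R) (F : nat -> R -> R) (f : R -> R) :
  {uniform A, F @ \oo --> f} <->
  forall e : R, 0 < e -> exists N, forall n, (N <= n)%N ->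
    forall t, A t -> `|F n t - f t| <= e.
Proof.
split=> [/uniform_ballP Ff e e0|Ff]; [|apply/uniform_ballP => e e0].
  have [N NF] := Ff _ e0; exists N => n Nn t At.
  by have := NF n Nn t At; rewrite /ball /= distrC => /ltW.
have [|N NF] := Ff (e / 2); first by rewrite divr_gt0.
exists N => n Nn t At; rewrite /ball /= distrC.
by rewrite (le_lt_trans (NF n Nn t At)) //; lra.
Qed.

(** For linear maps, an estimate on the unit ball is an estimate relative to the
    norm of the argument. *)
Lemma uniform_linearP (F : nat -> H -> H) (S : H -> H) :
  (forall n, linear (F n)) -> linear S ->
  {uniform [set x : H | `|x| <= 1], F @ \oo --> S} <->
  forall e : R, 0 < e -> exists N, forall n, (N <= n)%N ->
    forall x, rnorm (F n x - S x) <= e * rnorm x.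
Proof.
move=> lF lS; split=> [/uniform_ballP FS e e0|FS]; last first.
  apply/uniform_ballP => _ /realC_gt0[e e0 ->].
  have [|N NF] := FS (e / 2); first by rewrite divr_gt0.
  exists N => n Nn x; rewrite /= rnormE (lecR _ 1) => x1; rewrite ball_rnorm.
  rewrite (le_lt_trans (NF n Nn x)) //.
  rewrite (@le_lt_trans _ _ (e / 2 * 1)) ?ler_wpM2l //; lra.
have [|N NF] := FS e%:C; first by rewrite ltcR.
exists N => n Nn x.
have [/eqP/rnorm0_eq0 ->|x0] := boolP (rnorm x == 0).
  by rewrite (linear_op0 (lF n)) (linear_op0 lS) subr0 rnorm0 mulr0.
have xp : 0 < rnorm x by rewrite lt_def x0 rnorm_ge0.
have := NF n Nn ((rnorm x)^-1%:C *: x).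
rewrite /= ball_rnorm (linear_opZ _ _ (lF n)) (linear_opZ _ _ lS) -scalerBr.
rewrite rnormE !rnormZ ger0_norm ?invr_ge0 ?rnorm_ge0 // mulVf // lexx.
by move=> /(_ isT) /ltW; rewrite mulrC ler_pdivrMr.
Qed.

End Limits.

(** * Invertibility of coercive self-adjoint operators *)

Section SelfAdjointInvertibility.
Context {R : realType} {H : hilbertType R}.
Implicit Types (S T : H -> H) (x y : H).

(** Expand <T z, z> >= 0 at z = M x - T x.  This replaces the Cauchy-Schwarz
    inequality for the semi-definite form <T x, y>. *)
Lemma positive_sqnorm_le T (M : R) : self_adjoint T ->
  (forall x, 0 <= rinner (T x) x) -> 0 < M ->
  (forall x, rinner (T x) x <= M * rnorm x ^+ 2) ->
  forall x, rnorm (T x) ^+ 2 <= M * rinner (T x) x.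
Proof.
move=> sT T0 M0 TM x; have lT := self_adjoint_linear sT.
have := T0 (M%:C *: x - T x).
rewrite (linear_opB _ _ lT) (linear_opZ _ _ lT).
rewrite !(rinnerBl, rinnerBr, rinnerZl, rinnerZr).
rewrite (self_adjoint_rinner (T x) x sT) !rinner_sq => h.
rewrite -(ler_pM2l M0); have := TM (T x); lra.
Qed.

Lemma bounded_numerical_range T : bounded_operator T ->
  exists2 M : R, 0 < M & forall x, rinner (T x) x <= M * rnorm x ^+ 2.
Proof.
move=> /bounded_operatorP[_ [M M0 TM]]; exists M => // x.
by rewrite (le_trans (rinner_le _ _)) // expr2 mulrA ler_wpM2r ?rnorm_ge0.
Qed.

Lemma geometric_small (q e : R) : 0 <= q < 1 -> 0 < e ->
  exists N, forall n, (N <= n)%N -> q ^+ n <= e.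
Proof.
move=> /andP[q0 q1] e0.
have /cvgrPdist_le/(_ e e0)[N _ qN] : (q ^+ n) @[n --> \oo] --> 0.
  by apply: cvg_expr; rewrite ger0_norm.
by exists N => n /qN /=; rewrite sub0r normrN ger0_norm // exprn_ge0.
Qed.

(** Banach's theorem, proved directly because the scalars of [H] are complex while
    the contraction factor is real. *)
Lemma contraction_fixed_point (f : H -> H) (q : R) : 0 <= q < 1 ->
  (forall x y, rnorm (f x - f y) <= q * rnorm (x - y)) -> exists x, f x = x.
Proof.
move=> q01 fq; have /andP[q0 q1] := q01; pose u n := iter n f 0.
have q1' : 0 < 1 - q by rewrite subr_gt0.
pose d := rnorm (u 1%N - u 0%N).
have d0 : 0 <= d by exact: rnorm_ge0.
have step n : rnorm (u n.+1 - u n) <= q ^+ n * d.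
  elim: n => [|n IH]; first by rewrite expr0 mul1r.
  by rewrite (le_trans (fq _ _)) // exprS -mulrA ler_wpM2l.
have far n k : rnorm (u (n + k)%N - u n) * (1 - q) <= q ^+ n * (1 - q ^+ k) * d.
  elim: k => [|k IH]; first by rewrite addn0 !subrr rnorm0 mulr0 !mul0r.
  rewrite addnS -(subrKA (u (n + k)%N)).
  have := ler_rnormD (u (n + k).+1 - u (n + k)%N) (u (n + k)%N - u n).
  move=> /(ler_wpM2r (ltW q1'))/le_trans; apply; rewrite mulrDl.
  have := ler_wpM2r (ltW q1') (step (n + k)%N).
  rewrite exprD exprS; lra.
have bound n k : rnorm (u (n + k)%N - u n) <= q ^+ n * (d / (1 - q)).
  rewrite mulrA ler_pdivlMr // (le_trans (far n k)) // ler_wpM2r //.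
  rewrite ler_piMr ?exprn_ge0 // gerBl exprn_ge0 //.
pose D := d / (1 - q) + 1.
have D0 : 0 < D by rewrite ltr_wpDl // divr_ge0 // ltW.
have bound' n m : (n <= m)%N -> rnorm (u m - u n) <= q ^+ n * D.
  move=> nm; rewrite -(subnKC nm) (le_trans (bound _ _)) //.
  by rewrite ler_wpM2l ?exprn_ge0 // lerDl.
have [e e0|l ul] := @rnorm_complete _ _ u.
  have [|N qN] := geometric_small q01 (_ : 0 < e / 2 / D); first by rewrite !divr_gt0.
  exists N => m n Nm Nn.
  have := ler_rnormD (u m - u N) (- (u n - u N)); rewrite rnormN opprB subrKA.
  have qD : q ^+ N * D <= e / 2 by rewrite -ler_pdivlMr // qN.
  have := bound' _ _ Nm; have := bound' _ _ Nn; lra.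
exists l; apply/eqP; rewrite -subr_eq0; apply/eqP/rnorm0_eq0/le_anti.
rewrite rnorm_ge0 andbT; apply/ler_addgt0Pr => e e0; rewrite add0r.
have [|N uN] := ul (e / 2); first by rewrite divr_gt0.
have := ler_rnormD (f l - u N.+1) (u N.+1 - l); rewrite subrKA.
have qfl : rnorm (f l - u N.+1) <= rnorm (u N - l).
  rewrite (le_trans (fq _ _)) // -(rnormN (u N - l)) opprB.
  by rewrite ler_piMl ?rnorm_ge0 // ltW.
have := uN N (leqnn _); have := uN N.+1 (leqnSn _); lra.
Qed.

(** By [positive_sqnorm_le], <T x, x> dominates a multiple of |T x|^2, and the
    inverse bounds |x| by a multiple of |T x|. *)
Lemma invertible_coercive T : self_adjoint T ->
  (forall x, 0 <= rinner (T x) x) -> invertible_operator T ->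
  exists2 c : R, 0 < c & forall x, c * rnorm x ^+ 2 <= rinner (T x) x.
Proof.
move=> sT T0 [bT [S /bounded_operatorP[_ [K K0 SK]] [ST _]]].
have [M M0 TM] := bounded_numerical_range bT.
exists (K ^+ 2 * M)^-1 => [|x]; first by rewrite invr_gt0 mulr_gt0 ?exprn_gt0.
rewrite ler_pdivrMl ?mulr_gt0 ?exprn_gt0 // -mulrA.
have := positive_sqnorm_le sT T0 M0 TM x.
move=> /(ler_wpM2l (sqr_ge0 K)); apply: le_trans.
have := SK (T x); rewrite -[S (T x)]/((S \o T) x) ST => h.
by rewrite -exprMn ler_pXn2r ?nnegrE ?rnorm_ge0 // mulr_ge0 ?rnorm_ge0 // ltW.
Qed.

Lemma coercive_lower_bound T (c : R) : 0 < c ->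
  (forall x, c * rnorm x ^+ 2 <= rinner (T x) x) ->
  forall x, rnorm x <= c^-1 * rnorm (T x).
Proof.
move=> c0 Tc x; rewrite ler_pdivlMl //.
have [/eqP ->|x0] := boolP (rnorm x == 0); first by rewrite mulr0 rnorm_ge0.
have xp : 0 < rnorm x by rewrite lt_def x0 rnorm_ge0.
rewrite -(ler_pM2r xp) (le_trans _ (rinner_le _ _)) // -mulrA -expr2.
exact: Tc.
Qed.

Lemma onto_bounded_below_invertible T (K : R) : bounded_operator T ->
  0 < K -> (forall x, rnorm x <= K * rnorm (T x)) ->
  (forall y, exists x, T x = y) -> invertible_operator T.
Proof.
move=> bT K0 TK Tonto; have lT := bounded_linear bT.
have Tinj x y : T x = T y -> x = y.
  move=> e; apply/eqP; rewrite -subr_eq0; apply/eqP/rnorm0_eq0/le_anti.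
  by rewrite rnorm_ge0 (le_trans (TK _)) // (linear_opB _ _ lT) e subrr rnorm0 mulr0.
have [S TS] := choice Tonto.
split=> //; exists S; last by split; apply/funext => x /=; [exact: Tinj|exact: TS].
apply/bounded_operatorP; split=> [a x y|].
  by apply: Tinj; rewrite lT !TS.
by exists K => // x; rewrite (le_trans (TK _)) // TS.
Qed.

(** A lower bound on the quadratic form gives injectivity with bounded inverse;
    surjectivity comes from the iteration x |-> x + (y - T x) / M, whose fixed
    point solves T x = y.  For M large the linear part 1 - T / M has
    norm at most 1 - c / M. *)
Lemma coercive_invertible T (c : R) : self_adjoint T -> 0 < c ->
  (forall x, c * rnorm x ^+ 2 <= rinner (T x) x) -> invertible_operator T.
Proof.
move=> sT c0 Tc; have lT := self_adjoint_linear sT.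
have bT := self_adjoint_bounded sT.
have [M0 M00 TM0] := bounded_numerical_range bT.
pose M := M0 + c; have M_gt0 : 0 < M by exact: addr_gt0.
have TM x : rinner (T x) x <= M * rnorm x ^+ 2.
  by rewrite (le_trans (TM0 x)) // ler_wpM2r ?sqr_ge0 // lerDl ltW.
apply: (@onto_bounded_below_invertible _ c^-1) => //.
- by rewrite invr_gt0.
- exact: coercive_lower_bound.
move=> y.
(* the error operator M - T of the iteration x |-> x + (y - T x) / M has
   quadratic form between 0 and M - c *)
pose E : H -> H := M%:C *: id - T.
have sE : self_adjoint E.
  by apply: self_adjoint_sub => //; apply: self_adjoint_scale; exact: self_adjoint_id.
have EE x : rinner (E x) x = M * rnorm x ^+ 2 - rinner (T x) x.
  by rewrite /E !fctE rinnerBl rinnerZl rinner_sq.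
have [q01 q0] : 0 <= 1 - c / M < 1 /\ 0 <= 1 - c / M.
  have : 0 < c / M by rewrite divr_gt0.
  have : c / M <= 1 by rewrite ler_pdivrMr // mul1r lerDr ltW.
  lra.
have q1 : M * (1 - c / M) = M - c by rewrite mulrBr mulr1 mulrCA divff ?mulr1 // gt_eqF.
have Eq x : rnorm (E x) <= M * (1 - c / M) * rnorm x.
  have Mc : 0 < M - c by rewrite /M addrK.
  have E0 z : 0 <= rinner (E z) z by rewrite EE subr_ge0.
  have Ec z : rinner (E z) z <= (M - c) * rnorm z ^+ 2.
    by rewrite EE mulrBl lerB.
  have b0 : 0 <= (M - c) * rnorm x by rewrite mulr_ge0 ?rnorm_ge0 // ltW.
  rewrite q1 -(ler_pXn2r (_ : 0 < 2)%N) ?nnegrE ?rnorm_ge0 //.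
  rewrite (le_trans (positive_sqnorm_le sE E0 Mc Ec x)) //.
  by rewrite exprMn expr2 -mulrA ler_wpM2l // ltW.
(* (E x + y) / M = x + (y - T x) / M *)
have [x fx] : exists x, M^-1%:C *: (E x + y) = x.
  apply: (contraction_fixed_point q01) => x z.
  rewrite -scalerBr opprD addrACA subrr addr0 -(linear_opB _ _ (self_adjoint_linear sE)).
  rewrite rnormZ gtr0_norm ?invr_gt0 // ler_pdivrMl // mulrA; exact: Eq.
exists x; move/(congr1 (fun z => M%:C *: z)): fx.
rewrite scalerA -rmorphM /= divff ?gt_eqF // scale1r => h.
by apply: (addrI (E x)); rewrite h /E !fctE subrK.
Qed.

End SelfAdjointInvertibility.

(** * Polynomials in an operator *)

Section PolynomialsInAnOperator.
Context {R : realType} {H : hilbertType R}.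
Implicit Types (S T : H -> H) (x y : H) (p q : {poly R[i]}) (z : R[i]).

Definition complex_poly_operator p T : H -> H :=
  \sum_(i < size p) p`_i *: iter i T.

Lemma complex_poly_operatorE p T n x : (size p <= n)%N ->
  complex_poly_operator p T x = \sum_(i < n) p`_i *: iter i T x.
Proof.
move=> pn; rewrite /complex_poly_operator fct_sumE.
rewrite (big_ord_widen n (fun i => p`_i *: iter i T x)) // big_mkcond /=.
apply: eq_bigr => i _; case: ltnP => // pi.
by rewrite nth_default // scale0r.
Qed.

Lemma complex_poly_operatorD p q T : complex_poly_operator (p + q) T =
  complex_poly_operator p T + complex_poly_operator q T.
Proof.
apply/funext => x; rewrite fctE; pose n := maxn (size p) (size q).
rewrite !(@complex_poly_operatorE _ _ n) ?leq_maxl ?leq_maxr ?size_polyD //.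
by rewrite -big_split; apply: eq_bigr => i _; rewrite coefD scalerDl.
Qed.

Lemma complex_poly_operatorZ z p T :
  complex_poly_operator (z *: p) T = z *: complex_poly_operator p T.
Proof.
apply/funext => x; rewrite fctE.
rewrite !(@complex_poly_operatorE _ _ (size p)) ?size_scale_leq //.
by rewrite scaler_sumr; apply: eq_bigr => i _; rewrite coefZ scalerA.
Qed.

Lemma complex_poly_operatorC z T :
  complex_poly_operator z%:P T = z *: (id : H -> H).
Proof.
apply/funext => x; rewrite (@complex_poly_operatorE _ _ 1) ?size_polyC_leq1 //.
by rewrite big_ord1 coefC.
Qed.

Lemma complex_poly_operatorMX p T :
  complex_poly_operator (p * 'X) T = complex_poly_operator p T \o T.
Proof.
apply/funext => x /=; rewrite (@complex_poly_operatorE _ _ (size p).+1); last first.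
  by rewrite (leq_trans (size_polyMleq _ _)) // size_polyX addn2.
rewrite (@complex_poly_operatorE _ _ (size p)) // big_ord_recl coefMX scale0r add0r.
by apply: eq_bigr => i _; rewrite coefMX -iterSr.
Qed.

Lemma complex_poly_operator_cons p z T :
  complex_poly_operator (p * 'X + z%:P) T =
  complex_poly_operator p T \o T + z *: id.
Proof.
by rewrite complex_poly_operatorD complex_poly_operatorMX complex_poly_operatorC.
Qed.

Lemma bounded_poly p T :
  bounded_operator T -> bounded_operator (complex_poly_operator p T).
Proof.
move=> bT; elim/poly_ind: p => [|p z IH].
  rewrite -[0]/(0%:P) complex_poly_operatorC; apply: bounded_scale.
  exact: bounded_id.
rewrite complex_poly_operator_cons; apply: bounded_add.
  exact: bounded_comp.
by apply: bounded_scale; exact: bounded_id.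
Qed.

(** Evaluation at [T] is a ring morphism, which turns factorizations of
    polynomials into factorizations of operators. *)
Lemma complex_poly_operatorM p q T : bounded_operator T ->
  complex_poly_operator (p * q) T =
  complex_poly_operator p T \o complex_poly_operator q T.
Proof.
move=> bT; have lp := bounded_linear (bounded_poly p bT).
elim/poly_ind: q => [|q z IH].
  apply/funext => x /=; rewrite mulr0 -[0]/(0%:P) !complex_poly_operatorC !fctE.
  by rewrite !scale0r (linear_op0 lp).
apply/funext => x /=.
rewrite mulrDr mulrA [p * z%:P]mulrC mul_polyC complex_poly_operatorD.
rewrite complex_poly_operatorMX complex_poly_operatorZ IH.
rewrite complex_poly_operator_cons !fctE /=.
by rewrite (linear_opD _ _ lp) (linear_opZ _ _ lp).
Qed.

Lemma complex_poly_operator_sub z T :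
  complex_poly_operator ('X - z%:P) T = T - z *: id.
Proof.
rewrite -['X]mul1r -polyCN complex_poly_operator_cons scaleNr.
by rewrite -[1]/(1%:P) complex_poly_operatorC scale1r.
Qed.

Lemma invertible_comp S T :
  invertible_operator S -> invertible_operator T -> invertible_operator (S \o T).
Proof.
move=> [bS [S' bS' [S'S SS']]] [bT [T' bT' [T'T TT']]].
split; first exact: bounded_comp.
exists (T' \o S'); first exact: bounded_comp.
split; apply/funext => x /=.
- by rewrite -[S' (S _)]/((S' \o S) _) S'S; exact: (congr1 (fun f => f x) T'T).
- by rewrite -[T (T' _)]/((T \o T') _) TT'; exact: (congr1 (fun f => f x) SS').
Qed.

Lemma invertible_scale z : z != 0 -> invertible_operator (z *: (id : H -> H)).
Proof.
move=> z0; split; first by apply: bounded_scale; exact: bounded_id.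
exists (z^-1 *: (id : H -> H)); first by apply: bounded_scale; exact: bounded_id.
by split; apply/funext => x; rewrite /= !fctE scalerA ?mulVf ?mulfV // scale1r.
Qed.

(** A left factor of an invertible operator is onto, a right factor is bounded
    below, and commuting factors are both. *)
Lemma invertible_factor S T : bounded_operator S -> bounded_operator T ->
  S \o T = T \o S -> invertible_operator (S \o T) -> invertible_operator S.
Proof.
move=> bS bT ST [_ [V bV [VST STV]]].
have /bounded_operatorP[_ [K K0 VTK]] := bounded_comp bV bT.
apply: (@onto_bounded_below_invertible _ _ S K) => // [x|y].
  have {1}<- : V (T (S x)) = x.
    by rewrite -[T (S x)]/((T \o S) x) -ST; exact: (congr1 (fun f => f x) VST).
  exact: VTK.
by exists (T (V y)); exact: (congr1 (fun f => f y) STV).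
Qed.

(** The half of the spectral mapping theorem that holds because a complex
    polynomial splits into linear factors. *)
Lemma invertible_poly p T : bounded_operator T -> p != 0 ->
  (forall z, root p z -> invertible_operator (T - z *: id)) ->
  invertible_operator (complex_poly_operator p T).
Proof.
move=> bT p0 Tp; have [r pr] := closed_field_poly_normal p.
have : forall z, z \in r -> invertible_operator (T - z *: id).
  move=> z zr; apply: Tp; rewrite pr rootZ ?lead_coef_eq0 //.
  by rewrite root_prod_XsubC.
move: (lead_coef p) (lead_coef_eq0 p) pr => c.
rewrite (negPf p0) => /negbT c0 -> {Tp}.
rewrite -mul_polyC (complex_poly_operatorM _ _ bT) complex_poly_operatorC => Tr.
apply: invertible_comp; first exact: invertible_scale.
elim: r Tr => [|z r IH] Tr.
  rewrite big_nil -[1]/(1%:P) complex_poly_operatorC.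
  by apply: invertible_scale; exact: oner_neq0.
rewrite big_cons (complex_poly_operatorM _ _ bT) complex_poly_operator_sub.
apply: invertible_comp; first by apply: Tr; exact: mem_head.
by apply: IH => w wr; apply: Tr; rewrite inE wr orbT.
Qed.

End PolynomialsInAnOperator.

(** * Positivity of real polynomials on the spectrum *)

Section RealPolynomials.
Context {R : realType} {H : hilbertType R}.
Implicit Types (S T : H -> H) (x y : H) (p q : {poly R}) (a t : R).
Local Notation toC := (map_poly (real_complex R)).

Lemma poly_operatorE p T : poly_operator p T = complex_poly_operator (toC p) T.
Proof.
rewrite /poly_operator /complex_poly_operator size_map_poly.
by apply: eq_bigr => i _; rewrite coef_map.
Qed.

Lemma poly_operatorD p q T :
  poly_operator (p + q) T = poly_operator p T + poly_operator q T.
Proof. by rewrite !poly_operatorE rmorphD complex_poly_operatorD. Qed.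

Lemma poly_operatorC a T : poly_operator a%:P T = a%:C *: (id : H -> H).
Proof. by rewrite poly_operatorE map_polyC complex_poly_operatorC. Qed.

Lemma poly_operatorM p q T : bounded_operator T ->
  poly_operator (p * q) T = poly_operator p T \o poly_operator q T.
Proof. by move=> bT; rewrite !poly_operatorE rmorphM complex_poly_operatorM. Qed.

Lemma poly_operatorZ a p T : poly_operator (a *: p) T = a%:C *: poly_operator p T.
Proof.
rewrite !poly_operatorE -mul_polyC rmorphM /= map_polyC mul_polyC.
exact: complex_poly_operatorZ.
Qed.

Lemma poly_operatorB p q T :
  poly_operator (p - q) T = poly_operator p T - poly_operator q T.
Proof.
by rewrite poly_operatorD -[- q]scaleN1r poly_operatorZ rmorphN1 scaleN1r.
Qed.

Lemma poly_operatorX T : poly_operator 'X T = T.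
Proof.
rewrite poly_operatorE map_polyX -['X]subr0 -[0]/(0%:P).
by rewrite complex_poly_operator_sub scale0r subr0.
Qed.

Lemma bounded_poly_operator p T :
  bounded_operator T -> bounded_operator (poly_operator p T).
Proof. by rewrite poly_operatorE; exact: bounded_poly. Qed.

Lemma self_adjoint_poly p T :
  self_adjoint T -> self_adjoint (poly_operator p T).
Proof.
move=> sT; have bT := self_adjoint_bounded sT; apply/self_adjointP.
split=> [|x y]; first exact: bounded_poly_operator.
elim/poly_ind: p x y => [|p a IH] x y.
  by rewrite -[0]/(0%:P) poly_operatorC !fctE rinnerZl rinnerZr.
rewrite poly_operatorD poly_operatorC !fctE rinnerDl rinnerDr rinnerZl rinnerZr.
congr (_ + _); rewrite [in LHS]mulrC !(poly_operatorM _ _ bT) poly_operatorX /=.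
by rewrite self_adjoint_rinner.
Qed.

(** For z = a + i b, the product of T - z and its conjugate is
    (T - a)^2 + b^2, which is bounded below by b^2. *)
Lemma nonreal_invertible T a b : self_adjoint T -> b != 0 ->
  invertible_operator (T - (a +i* b) *: id).
Proof.
move=> sT b0; have bT := self_adjoint_bounded sT.
have factors : toC (('X - a%:P) * ('X - a%:P) + (b ^+ 2)%:P) =
    ('X - (a +i* b)%:P) * ('X - (a -i* b)%:P).
  have toX : toC ('X - a%:P) = 'X - a%:C%:P.
    by rewrite rmorphB /= map_polyX map_polyC.
  rewrite rmorphD /= rmorphM /= toX map_polyC /= rmorphXn /= polyC_exp.
  have -> : a +i* b = a%:C + 'i%C * b%:C by rewrite {1}(complexE (a +i* b)).
  have -> : a -i* b = a%:C - 'i%C * b%:C.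
    by rewrite {1}(complexE (a -i* b)) /= rmorphN mulrN.
  have i2 : ('i%C : R[i])%:P * 'i%C%:P = -1 :> {poly R[i]}.
    by rewrite -polyCM -expr2 sqr_i polyCN.
  rewrite !(polyCD, polyCN, polyCM).
  have -> : forall X A I B : {poly R[i]},
    (X - (A + I * B)) * (X - (A - I * B)) = (X - A) * (X - A) - (I * I) * B ^+ 2.
    by move=> X A I B; ring.
  by rewrite i2 mulN1r opprK.
set p := _ + _ in factors.
have : invertible_operator (poly_operator p T).
  apply: (@coercive_invertible _ _ _ (b ^+ 2)).
  - exact: self_adjoint_poly.
  - by rewrite exprn_even_gt0.
  move=> x; rewrite /p poly_operatorD poly_operatorC (poly_operatorM _ _ bT).
  rewrite !fctE /= rinnerDl rinnerZl rinner_sq.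
  have sq := self_adjoint_poly ('X - a%:P) sT.
  by rewrite (self_adjoint_rinner _ _ sq) rinner_sq lerDr sqr_ge0.
rewrite poly_operatorE factors (complex_poly_operatorM _ _ bT).
rewrite !complex_poly_operator_sub; apply: invertible_factor.
- by rewrite -complex_poly_operator_sub; exact: bounded_poly.
- by rewrite -complex_poly_operator_sub; exact: bounded_poly.
- by rewrite -!complex_poly_operator_sub -!complex_poly_operatorM // mulrC.
Qed.

(** The spectral value is the infimum m of the quadratic form on the unit sphere:
    T - m >= 0, and if T - m were invertible it would be bounded below, so that m
    would not be the infimum. *)
Lemma spectrum_meets_numerical_range T x : self_adjoint T -> x <> 0 ->
  exists2 m : R, spectrum T m%:C & m * rnorm x ^+ 2 <= rinner (T x) x.
Proof.
move=> sT x0; have bT := self_adjoint_bounded sT; have lT := self_adjoint_linear sT.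
pose W := [set r | exists2 y, rnorm y = 1 & r = rinner (T y) y].
have normalize y : y <> 0 -> W (rinner (T y) y / rnorm y ^+ 2).
  move=> y0; have ny : rnorm y != 0 by apply/eqP => /rnorm0_eq0.
  have nyp : 0 < rnorm y by rewrite lt_def ny rnorm_ge0.
  exists ((rnorm y)^-1%:C *: y).
    by rewrite rnormZ ger0_norm ?invr_ge0 ?rnorm_ge0 // mulVf.
  rewrite (linear_opZ _ _ lT) rinnerZl rinnerZr mulrA mulrC; congr (_ * _).
  by rewrite -expr2 exprVn.
have Wlb : has_lbound W.
  have /bounded_operatorP[_ [M M0 TM]] := bT.
  exists (- M) => _ [y y1 ->].
  have := rinner_ge (T y) y; rewrite y1 mulr1; apply: le_trans.
  by rewrite lerN2 (le_trans (TM y)) // y1 mulr1.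
have Wn0 : W !=set0 by eexists; exact: normalize x0.
have Winf : has_inf W by [].
have mW y : inf W * rnorm y ^+ 2 <= rinner (T y) y.
  have [->|y0] := pselect (y = 0); first by rewrite rnorm0 expr0n mulr0 rinner0r.
  have nyp : 0 < rnorm y by rewrite lt_def rnorm_ge0 andbT; apply/eqP => /rnorm0_eq0.
  rewrite -ler_pdivlMr ?exprn_gt0 //; apply: ge_inf => //; exact: normalize.
exists (inf W) => //.
have sTm : self_adjoint (T - (inf W)%:C *: id).
  by apply: self_adjoint_sub => //; apply: self_adjoint_scale; exact: self_adjoint_id.
have TmE y : rinner ((T - (inf W)%:C *: id) y) y =
    rinner (T y) y - inf W * rnorm y ^+ 2.
  by rewrite !fctE rinnerBl rinnerZl rinner_sq.
move=> /(invertible_coercive sTm)[y|c c0 Tc]; first by rewrite TmE subr_ge0.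
have : inf W + c <= inf W.
  apply: lb_le_inf => // _ [y y1 ->].
  by have := Tc y; rewrite TmE y1 expr1n !mulr1; lra.
lra.
Qed.

(** Otherwise some m < 0 belongs to the spectrum of p(T).  As p(T) - m factors
    over the roots of p - m, one of these roots lies in the spectrum of T, hence
    is real, and p takes the value m < 0 there. *)
Lemma poly_operator_ge0 p T : self_adjoint T ->
  (forall t, spectrum T t%:C -> 0 <= p.[t]) ->
  forall x, 0 <= rinner (poly_operator p T x) x.
Proof.
move=> sT p0 x; have bT := self_adjoint_bounded sT.
rewrite leNgt; apply/negP => px.
have x0 : x <> 0 by move=> xe; move: px; rewrite xe rinner0r ltxx.
have [m mS mx] := spectrum_meets_numerical_range (self_adjoint_poly p sT) x0.
have m0 : m < 0.
  rewrite ltNge; apply/negP => m0; have := lt_le_trans px (_ : 0 <= m * rnorm x ^+ 2).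
  by rewrite mulr_ge0 ?sqr_ge0 // => /(_ isT) /(le_lt_trans mx); rewrite ltxx.
suff [t tT pt] : exists2 t, spectrum T t%:C & p.[t] = m.
  by have := p0 _ tT; rewrite pt leNgt m0.
(* a constant p has no roots to locate, but the spectrum of T is not empty *)
have [/eqP pm|pm] := boolP (p - m%:P == 0).
  have [t tT _] := spectrum_meets_numerical_range sT x0.
  by exists t => //; move/eqP: pm; rewrite subr_eq0 => /eqP ->; rewrite hornerC.
have [//|notin] := pselect (exists2 t, spectrum T t%:C & p.[t] = m).
exfalso; apply: mS; rewrite -(poly_operatorC m T) -poly_operatorB poly_operatorE.
apply: invertible_poly => //; first by rewrite map_poly_eq0.
move=> [a b] rab.
have [b0|b0] := eqVneq b 0; last exact: nonreal_invertible.
rewrite b0 in rab *; apply: contrapT => Ta; apply: notin; exists a => //.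
move: rab; rewrite /root complexr0 horner_map -(rmorph0 (real_complex R)).
by move=> /eqP /complexI /eqP; rewrite hornerD hornerN hornerC subr_eq0 => /eqP.
Qed.

(** Positivity of e^2 - p(T)^2 says that |p(T) x|^2 <= e^2 |x|^2. *)
Lemma poly_operator_norm_le p T (e : R) : self_adjoint T -> 0 <= e ->
  (forall t, spectrum T t%:C -> `|p.[t]| <= e) ->
  forall x, rnorm (poly_operator p T x) <= e * rnorm x.
Proof.
move=> sT e0 pe x; have bT := self_adjoint_bounded sT.
have : 0 <= rinner (poly_operator ((e ^+ 2)%:P - p * p) T x) x.
  apply: poly_operator_ge0 => // t /pe; rewrite !(hornerE) => pt.
  by rewrite subr_ge0 -expr2 -real_normK ?num_real // ler_pXn2r ?nnegrE.
rewrite poly_operatorB poly_operatorC (poly_operatorM _ _ bT) !fctE /=.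
rewrite rinnerBl rinnerZl (self_adjoint_rinner _ _ (self_adjoint_poly p sT)).
rewrite !rinner_sq subr_ge0 -exprMn ler_pXn2r ?nnegrE ?rnorm_ge0 //.
by rewrite mulr_ge0 ?rnorm_ge0.
Qed.

End RealPolynomials.

(** * The functional calculus of a self-adjoint operator *)

Section FunctionalCalculus.
Context {R : realType} {H : hilbertType R}.
Context (T : H -> H) (sT : self_adjoint T).
Implicit Types (S : H -> H) (x y : H) (f g : R -> R) (p q : {poly R}).

Let bT : bounded_operator T := self_adjoint_bounded sT.

Lemma harmonic_small (e : R) : 0 < e ->
  exists N, forall n, (N <= n)%N -> n.+1%:R^-1 <= e.
Proof.
move=> e0; have /cvgrPdist_le/(_ e e0)[N _ eN] := @cvg_harmonic R.
by exists N => n /eN /=; rewrite sub0r normrN ger0_norm.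
Qed.

Lemma small_multiple (r d : R) : 0 <= r -> 0 < d ->
  exists2 e, 0 < e & e * r <= d.
Proof.
move=> r0 d0; have r1 : 0 < r + 1 by rewrite ltr_wpDl.
exists (d / (r + 1)); first exact: divr_gt0.
rewrite mulrAC ler_pdivrMr // mulrDr mulr1 lerDl; exact: ltW.
Qed.

(** Choosing approximations with error 1 / (n + 1) gives back the sequence of
    polynomials, so that one polynomial for each error is enough. *)
Lemma functional_calculusP f S : is_functional_calculus f T S <->
  bounded_operator S /\ forall e : R, 0 < e -> exists p,
    (forall t, spectrum T t%:C -> `|p.[t] - f t| <= e) /\
    (forall x, rnorm (poly_operator p T x - S x) <= e * rnorm x).
Proof.
have lp p : linear (poly_operator p T) := bounded_linear (bounded_poly_operator p bT).
split=> -[bS]; have lS := bounded_linear bS.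
  move=> [p [/uniform_realP pf /(uniform_linearP (fun n => lp (p n)) lS) pS]].
  split=> // e e0; have [N fN] := pf e e0; have [M SM] := pS e e0.
  exists (p (maxn N M)); split=> [t|x]; first by apply: fN; rewrite leq_maxl.
  by apply: SM; rewrite leq_maxr.
move=> fS; have [n|p pP] := choice (fun n => fS n.+1%:R^-1 _).
  by rewrite invr_gt0.
split=> //; exists p; split.
  apply/uniform_realP => e /harmonic_small[N Ne]; exists N => n /Ne ne t Tt.
  by rewrite (le_trans _ ne) //; exact: (pP n).1.
apply/uniform_linearP => // e /harmonic_small[N Ne]; exists N => n /Ne ne x.
by rewrite (le_trans ((pP n).2 x)) // ler_wpM2r ?rnorm_ge0.
Qed.

Lemma functional_calculus_poly p :
  is_functional_calculus (fun t => p.[t]) T (poly_operator p T).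
Proof.
apply/functional_calculusP; split=> [|e e0]; first exact: bounded_poly_operator.
exists p; split=> [t _|x]; first by rewrite subrr normr0 ltW.
by rewrite subrr rnorm0 mulr_ge0 ?rnorm_ge0 ?ltW.
Qed.

Lemma functional_calculus_cst a :
  is_functional_calculus (fun=> a) T (a%:C *: (id : H -> H)).
Proof.
have := functional_calculus_poly a%:P; rewrite poly_operatorC.
by have -> : horner a%:P = (fun=> a) by apply/funext => t; rewrite hornerC.
Qed.

Lemma functional_calculus_id : is_functional_calculus (fun t => t) T T.
Proof.
have := functional_calculus_poly 'X; rewrite poly_operatorX.
by have -> : horner 'X = (fun t : R => t) by apply/funext => t; rewrite hornerX.
Qed.

Lemma functional_calculus_add f g S1 S2 :
  is_functional_calculus f T S1 -> is_functional_calculus g T S2 ->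
  is_functional_calculus (fun t => f t + g t) T (S1 + S2).
Proof.
move=> /functional_calculusP[bS1 fS1] /functional_calculusP[bS2 fS2].
apply/functional_calculusP; split=> [|e e0]; first exact: bounded_add.
have e20 : 0 < e / 2 by rewrite divr_gt0.
have [p [pf pS]] := fS1 _ e20; have [q [qg qS]] := fS2 _ e20.
exists (p + q); split=> [t Tt|x].
  rewrite hornerD opprD addrACA (le_trans (ler_normD _ _)) //.
  by have := pf t Tt; have := qg t Tt; lra.
rewrite poly_operatorD !fctE opprD addrACA (le_trans (ler_rnormD _ _)) //.
by have := pS x; have := qS x; lra.
Qed.

Lemma functional_calculus_scale a f S : is_functional_calculus f T S ->
  is_functional_calculus (fun t => a * f t) T (a%:C *: S).
Proof.
move=> /functional_calculusP[bS fS].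
apply/functional_calculusP; split=> [|e e0]; first exact: bounded_scale.
have a0 : 0 < `|a| + 1 by rewrite ltr_wpDl.
have [p [pf pS]] := fS (e / (`|a| + 1)) (divr_gt0 e0 a0).
have ae (r : R) : 0 <= r -> `|a| * (e / (`|a| + 1) * r) <= e * r.
  move=> r0; rewrite mulrA ler_wpM2r // mulrA ler_pdivrMr // mulrC.
  by rewrite ler_wpM2l ?lerDl ?ltW.
exists (a *: p); split=> [t Tt|x].
  rewrite hornerZ -mulrBr normrM (le_trans (ler_wpM2l _ (pf t Tt))) //.
  by have := ae 1 ler01; rewrite !mulr1.
rewrite poly_operatorZ !fctE -scalerBr rnormZ.
by rewrite (le_trans (ler_wpM2l _ (pS x))) // ae ?rnorm_ge0.
Qed.

Lemma functional_calculus_mul (K : R) f g S1 S2 :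
  (forall t, spectrum T t%:C -> `|f t| <= K) ->
  (forall t, spectrum T t%:C -> `|g t| <= K) ->
  is_functional_calculus f T S1 -> is_functional_calculus g T S2 ->
  is_functional_calculus (fun t => f t * g t) T (S1 \o S2).
Proof.
move=> fK gK /functional_calculusP[bS1 fS1] /functional_calculusP[bS2 fS2].
have lS1 := bounded_linear bS1.
apply/functional_calculusP; split=> [|e e0]; first exact: bounded_comp.
have /bounded_operatorP[_ [K1 K10 S1K]] := bS1.
have /bounded_operatorP[_ [K2 K20 S2K]] := bS2.
(* d is small enough for d (L + L + d) <= e, L bounding f, g, S1 and S2 *)
pose L := `|K| + K1 + K2; pose d := Num.min 1 (e / (2 * L + 1)).
have LK : K <= L by have := ler_norm K; rewrite /L; lra.
have LK1 : K1 <= L by have := normr_ge0 K; rewrite /L; lra.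
have LK2 : K2 <= L by have := normr_ge0 K; rewrite /L; lra.
have L0 : 0 < L by lra.
have d0 : 0 < d by rewrite lt_min ltr01 divr_gt0 //; lra.
have de : d * (L + L + d) <= e.
  have : d <= 1 by rewrite ge_min lexx.
  have : d * (2 * L + 1) <= e.
    by rewrite -ler_pdivlMr ?ge_min ?lexx ?orbT //; lra.
  move: d0; clear -L0; nra.
have [p [pf pS]] := fS1 _ d0; have [q [qg qS]] := fS2 _ d0.
exists (p * q); split=> [t Tt|x].
  have -> : (p * q).[t] - f t * g t =
      (p.[t] - f t) * g t + f t * (q.[t] - g t) + (p.[t] - f t) * (q.[t] - g t).
    by rewrite hornerM; ring.
  apply: le_trans de; rewrite (le_trans (ler_normD _ _)) //.
  have -> : d * (L + L + d) = d * L + L * d + d * d by ring.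
  rewrite lerD //; last by rewrite normrM ler_pM // ?pf ?qg.
  rewrite (le_trans (ler_normD _ _)) // lerD // normrM ler_pM // ?pf ?qg //.
    by rewrite (le_trans (gK _ Tt)).
  by rewrite (le_trans (fK _ Tt)).
rewrite (poly_operatorM _ _ bT) /=.
set u := poly_operator q T x; have ux := qS x; rewrite -/u in ux.
have -> : poly_operator p T u - S1 (S2 x) =
    (poly_operator p T u - S1 u) + S1 (u - S2 x).
  by rewrite (linear_opB _ _ lS1) subrKA.
rewrite (le_trans (ler_rnormD _ _)) //.
have nu : rnorm u <= (L + d) * rnorm x.
  have := ler_rnormD (u - S2 x) (S2 x); rewrite subrK.
  have := S2K x; have := ler_wpM2r (rnorm_ge0 x) LK2; lra.
have h1 := ler_wpM2l (ltW d0) nu.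
have h2 := ler_wpM2r (rnorm_ge0 x) de.
have h3 := ler_wpM2r (rnorm_ge0 (u - S2 x)) LK1.
have h4 := ler_wpM2l (ltW L0) ux.
have := pS u; have := S1K (u - S2 x); lra.
Qed.

(** Two approximating polynomials are close to each other on the spectrum, so
    their values at [T] are close in norm by [poly_operator_norm_le]. *)
Lemma functional_calculus_uniq f g S1 S2 :
  (forall t, spectrum T t%:C -> f t = g t) ->
  is_functional_calculus f T S1 -> is_functional_calculus g T S2 -> S1 = S2.
Proof.
move=> fg /functional_calculusP[bS1 fS1] /functional_calculusP[bS2 fS2].
apply/funext => x; apply/eqP; rewrite -subr_eq0; apply/eqP/rnorm0_eq0/le_anti.
rewrite rnorm_ge0 andbT; apply/ler_addgt0Pr => d d0; rewrite add0r.
have [e e0 ed] := small_multiple (mulr_ge0 (ler0n R 4) (rnorm_ge0 x)) d0.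
have [p [pf pS]] := fS1 _ e0; have [q [qg qS]] := fS2 _ e0.
have pq t : spectrum T t%:C -> `|(p - q).[t]| <= e + e.
  move=> Tt; rewrite hornerD hornerN -(subrKA (f t)).
  rewrite (le_trans (ler_normD _ _)) // lerD ?pf // {1}fg // distrC; exact: qg.
have := pS x; rewrite -rnormN opprB => hp; have hq := qS x.
have hpq := poly_operator_norm_le sT (ltW (addr_gt0 e0 e0)) pq x.
move: hpq; rewrite poly_operatorB !fctE => hpq.
have := ler_rnormD (S1 x - poly_operator p T x) (poly_operator p T x - S2 x).
have := ler_rnormD (poly_operator p T x - poly_operator q T x)
  (poly_operator q T x - S2 x).
rewrite !subrKA; lra.
Qed.

Lemma functional_calculus_self_adjoint f S :
  is_functional_calculus f T S -> self_adjoint S.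
Proof.
move=> /functional_calculusP[bS fS]; apply/self_adjointP; split=> // x y.
apply/eqP; rewrite -subr_eq0 -normr_le0; apply/ler_addgt0Pr => d d0; rewrite add0r.
have [e e0 ed] := small_multiple
  (mulr_ge0 (ler0n R 2) (mulr_ge0 (rnorm_ge0 x) (rnorm_ge0 y))) d0.
have [p [_ pS]] := fS _ e0.
have := rinner_le (poly_operator p T x - S x) y.
have := rinner_ge (poly_operator p T x - S x) y.
have := rinner_le x (poly_operator p T y - S y).
have := rinner_ge x (poly_operator p T y - S y).
rewrite !(rinnerBl, rinnerBr) (self_adjoint_rinner _ _ (self_adjoint_poly p sT)).
have := ler_wpM2r (rnorm_ge0 y) (pS x); have := ler_wpM2l (rnorm_ge0 x) (pS y).
rewrite ler_norml; lra.
Qed.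

(** If p is within e of f on the spectrum, then p + e >= 0 there, and
    [poly_operator_ge0] applies to p + e. *)
Lemma functional_calculus_ge0 f S :
  (forall t, spectrum T t%:C -> 0 <= f t) ->
  is_functional_calculus f T S -> positive_operator S.
Proof.
move=> f0 fcS; apply/positive_operatorP; split.
  exact: functional_calculus_self_adjoint fcS.
move=> x; have /functional_calculusP[bS fS] := fcS.
apply/ler_addgt0Pr => d d0.
have [e e0 ed] := small_multiple (mulr_ge0 (ler0n R 2) (sqr_ge0 (rnorm x))) d0.
have [p [pf pS]] := fS _ e0.
have : 0 <= rinner (poly_operator (p + e%:P) T x) x.
  apply: poly_operator_ge0 => // t Tt; rewrite hornerD hornerC.
  have := pf t Tt; rewrite ler_norml; have := f0 t Tt; lra.
rewrite poly_operatorD poly_operatorC !fctE rinnerDl rinnerZl rinner_sq.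
have := rinner_le (poly_operator p T x - S x) x.
have := ler_wpM2r (rnorm_ge0 x) (pS x).
rewrite rinnerBl -mulrA -expr2; lra.
Qed.

(** By [poly_operator_norm_le], polynomials that converge uniformly on the
    spectrum give a Cauchy sequence of operators. *)
Lemma functional_calculus_exists f :
  (forall e : R, 0 < e -> exists p,
     forall t, spectrum T t%:C -> `|p.[t] - f t| <= e) ->
  is_functional_calculus f T (functional_calculus f T).
Proof.
move=> fp; suff: exists S, is_functional_calculus f T S by exact: xgetPex.
have [n|p pf] := choice (fun n => fp n.+1%:R^-1 _); first by rewrite invr_gt0.
pose P n := poly_operator (p n) T; pose r n : R := n.+1%:R^-1.
have r0 n : 0 <= r n by rewrite invr_ge0.
have lP n : linear (P n) := bounded_linear (bounded_poly_operator (p n) bT).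
have PC m n x : rnorm (P m x - P n x) <= (r m + r n) * rnorm x.
  rewrite /P -[_ - _]/((poly_operator (p m) T - poly_operator (p n) T) x).
  rewrite -poly_operatorB; apply: poly_operator_norm_le => // [|t Tt].
    by rewrite addr_ge0.
  rewrite hornerD hornerN -(subrKA (f t)).
  by rewrite (le_trans (ler_normD _ _)) // lerD ?pf // distrC pf.
have [x|S PS] := choice (fun x => rnorm_complete (_ : forall e : R, 0 < e ->
    exists N, forall m n, (N <= m)%N -> (N <= n)%N -> rnorm (P m x - P n x) <= e)).
  move=> d d0.
  have [e e0 ed] := small_multiple (mulr_ge0 (ler0n R 2) (rnorm_ge0 x)) d0.
  have [N Ne] := harmonic_small e0; exists N => m n /Ne me /Ne ne.
  rewrite (le_trans (PC m n x)) //.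
  have := ler_wpM2r (rnorm_ge0 x) me; have := ler_wpM2r (rnorm_ge0 x) ne.
  rewrite -/(r m) -/(r n); lra.
have PSr n x : rnorm (P n x - S x) <= r n * rnorm x.
  apply/ler_addgt0Pr => d d0.
  have [e e0 ed] := small_multiple (mulr_ge0 (ler0n R 2) (rnorm_ge0 x)) d0.
  have [N Ne] := harmonic_small e0.
  have [|M Me] := PS x (d / 2); first by rewrite divr_gt0.
  pose m := maxn N M; have me := Ne m (leq_maxl _ _); have := Me m (leq_maxr _ _).
  have := ler_rnormD (P n x - P m x) (P m x - S x); rewrite subrKA.
  have := PC n m x; have := ler_wpM2r (rnorm_ge0 x) me; rewrite -/(r m); lra.
have lS : linear S.
  move=> a x y; apply/eqP; rewrite -subr_eq0; apply/eqP/rnorm0_eq0/le_anti.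
  rewrite rnorm_ge0 andbT; apply/ler_addgt0Pr => d d0; rewrite add0r.
  pose D := rnorm (a *: x + y) + complex.Re `|a| * rnorm x + rnorm y.
  have a0 : 0 <= complex.Re `|a|.
    by rewrite -lecR RRe_real ?normr_ge0 ?normr_real.
  have D0 : 0 <= D by rewrite !addr_ge0 ?rnorm_ge0 // mulr_ge0 ?rnorm_ge0.
  have [e e0 ed] := small_multiple D0 d0.
  have [N /(_ N (leqnn _)) /(ler_wpM2r D0)] := harmonic_small e0.
  move=> /le_trans/(_ ed); rewrite -/(r N) => rD.
  have -> : S (a *: x + y) - (a *: S x + S y) =
     - (P N (a *: x + y) - S (a *: x + y)) + a *: (P N x - S x) + (P N y - S y).
    by rewrite lP scalerBr opprB -addrA [X in _ = _ + X]addrACA -opprD subrKA.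
  have := ler_rnormD (- (P N (a *: x + y) - S (a *: x + y)) + a *: (P N x - S x))
     (P N y - S y).
  have := ler_rnormD (- (P N (a *: x + y) - S (a *: x + y))) (a *: (P N x - S x)).
  rewrite rnormN rnormZ_complex.
  have := PSr N (a *: x + y); have := PSr N y.
  have := ler_wpM2l a0 (PSr N x).
  move: rD; rewrite /D; lra.
exists S; apply/functional_calculusP; split=> [|e e0].
  apply/bounded_operatorP; split=> //.
  have /bounded_operatorP[_ [M M0 PM]] := bounded_poly_operator (p 0%N) bT.
  exists (M + 1) => [|x]; first by rewrite ltr_wpDl // ltW.
  have := ler_rnormD (- (P 0%N x - S x)) (P 0%N x); rewrite rnormN.
  rewrite opprB subrK; have := PM x; have := PSr 0%N x; rewrite /r invr1 /P; lra.
have [N Ne] := harmonic_small e0; exists (p N); split=> [t Tt|x].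
  by rewrite (le_trans (pf N t Tt)) // Ne.
by rewrite (le_trans (PSr N x)) // ler_wpM2r ?rnorm_ge0 // Ne.
Qed.

End FunctionalCalculus.

(** * Polynomial approximation of Lipschitz functions *)

Section Bernstein.
Context {R : realType}.
Implicit Types (g h : nat -> R) (x : R).

(** The Bernstein polynomial of degree n of a sequence of samples g 0, ..., g n,
    defined by one step of the binomial random walk instead of binomial
    coefficients.  All the properties below are then inductions on n. *)
Fixpoint bernstein (n : nat) g : {poly R} :=
  if n is m.+1 then
    (1 - 'X) * bernstein m g + 'X * bernstein m (fun k => g k.+1)
  else (g 0%N)%:P.

Lemma bernsteinS n g x : (bernstein n.+1 g).[x] =
  (1 - x) * (bernstein n g).[x] + x * (bernstein n (fun k => g k.+1)).[x].
Proof. by rewrite /= !hornerE. Qed.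

(** On [0, 1] a Bernstein polynomial is an average of the sampled values. *)
Lemma bernstein_le n g h x : 0 <= x <= 1 ->
  (forall k, (k <= n)%N -> g k <= h k) ->
  (bernstein n g).[x] <= (bernstein n h).[x].
Proof.
move=> x01; elim: n g h => [|n IH] g h gh; first by rewrite /= !hornerC gh.
have /andP[x0 x1] := x01; rewrite !bernsteinS lerD // ler_wpM2l ?subr_ge0 //.
  by apply: IH => k kn; rewrite gh // leqW.
by apply: IH => k kn; exact: gh.
Qed.

Lemma bernstein_affine n (a c : R) g x :
  (bernstein n (fun k => a + c * g k)).[x] = a + c * (bernstein n g).[x].
Proof.
elim: n g => [|n IH] g; first by rewrite /= !hornerC.
by rewrite !bernsteinS !IH; ring.
Qed.

(** The moment about - a of the binomial law: variance plus squared mean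
    deviation.  A general shift a is what makes the induction go through. *)
Lemma bernstein_second_moment n (a x : R) :
  (bernstein n (fun k => (k%:R + a) ^+ 2)).[x] =
  n%:R * x * (1 - x) + (n%:R * x + a) ^+ 2.
Proof.
elim: n a => [|n IH] a; first by rewrite /= !hornerE.
rewrite bernsteinS IH.
under eq_fun => k do rewrite -natr1 -addrA.
by rewrite IH -natr1; ring.
Qed.

(** By the inequality L u <= e / 2 + L^2 u^2 / (2 e), the error
    |f (k / n) - f t| is controlled by the second moment of k - n t, which is the
    only moment that has to be known. *)
Lemma bernstein_approx (f : R -> R) (L e : R) : 0 < e -> 0 <= L ->
  (forall s t, 0 <= s <= 1 -> 0 <= t <= 1 -> `|f s - f t| <= L * `|s - t|) ->
  exists p : {poly R}, forall t, 0 <= t <= 1 -> `|p.[t] - f t| <= e.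
Proof.
move=> e0 L0 fL.
(* n is large enough for L^2 / (2 e n) <= e / 2 *)
pose n := (Num.truncn (L ^+ 2 / e ^+ 2)).+1; have n0 : 0 < n%:R :> R by rewrite ltr0n.
have nL : L ^+ 2 <= n%:R * e ^+ 2.
  by rewrite -ler_pdivrMr ?exprn_gt0 // ltW // truncnS_gt.
exists (bernstein n (fun k => f (k%:R / n%:R))) => t t01; have /andP[t0 t1] := t01.
pose q := L ^+ 2 / (2 * e * n%:R ^+ 2).
have q0 : 0 <= q by rewrite divr_ge0 ?sqr_ge0 // !mulr_ge0 // ltW.
pose dev k : R := e / 2 + q * (k%:R + - (n%:R * t)) ^+ 2.
(* the variance of the binomial law is n t (1 - t), at most n *)
have devE : (bernstein n dev).[t] <= e.
  rewrite bernstein_affine bernstein_second_moment subrr expr0n addr0.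
  have : q * (n%:R * t * (1 - t)) <= q * n%:R.
    rewrite ler_wpM2l // -mulrA ler_piMr ?ler0n // -[leRHS]mulr1 ler_pM ?subr_ge0 //.
    by rewrite gerBl.
  have : q * n%:R <= e / 2.
    have -> : q * n%:R = L ^+ 2 / (2 * e * n%:R).
      by rewrite /q; field; rewrite !gt_eqF.
    rewrite ler_pdivrMr ?mulr_gt0 //; move: nL; lra.
  lra.
have fdev k : (k <= n)%N -> `|f (k%:R / n%:R) - f t| <= dev k.
  move=> kn; have k01 : 0 <= (k%:R / n%:R : R) <= 1.
    by rewrite divr_ge0 //= ler_pdivrMr // mul1r ler_nat.
  rewrite (le_trans (fL _ _ k01 t01)) // /dev.
  have -> : k%:R / n%:R - t = (k%:R + - (n%:R * t)) / n%:R.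
    by field; rewrite gt_eqF.
  set u := k%:R + _; rewrite normrM normfV (gtr0_norm n0).
  have -> : q * u ^+ 2 = (L * (`|u| / n%:R)) ^+ 2 / (2 * e).
    by rewrite -(real_normK (num_real u)) /q; field; rewrite !gt_eqF.
  set w := L * _; rewrite -(ler_pM2r (_ : 0 < 2 * e)) ?mulr_gt0 //.
  have -> : (e / 2 + w ^+ 2 / (2 * e)) * (2 * e) = e ^+ 2 + w ^+ 2.
    by field; rewrite gt_eqF.
  by have := sqr_ge0 (w - e); lra.
rewrite ler_norml; apply/andP; split.
  have : (bernstein n (fun k => f t + (-1) * dev k)).[t] <=
      (bernstein n (fun k => f (k%:R / n%:R))).[t].
    by apply: bernstein_le => // k /fdev; rewrite ler_norml; lra.
  by rewrite bernstein_affine; move: devE; lra.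
have : (bernstein n (fun k => f (k%:R / n%:R))).[t] <=
    (bernstein n (fun k => f t + 1 * dev k)).[t].
  by apply: bernstein_le => // k /fdev; rewrite ler_norml; lra.
by rewrite bernstein_affine; move: devE; lra.
Qed.

Lemma lipschitz_poly_approx (f : R -> R) (a b L e : R) : 0 < e -> a < b -> 0 <= L ->
  (forall s t, a <= s <= b -> a <= t <= b -> `|f s - f t| <= L * `|s - t|) ->
  exists p : {poly R}, forall t, a <= t <= b -> `|p.[t] - f t| <= e.
Proof.
move=> e0 ab L0 fL; have d0 : 0 < b - a by rewrite subr_gt0.
have inab s : 0 <= s <= 1 -> a <= a + (b - a) * s <= b.
  move=> /andP[s0 s1]; have := mulr_ge0 (ltW d0) s0.
  have := ler_wpM2l (ltW d0) s1; lra.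
have [|s t s01 t01|p pf] :=
  @bernstein_approx (fun s => f (a + (b - a) * s)) (L * (b - a)) e e0.
- by rewrite mulr_ge0 // ltW.
- rewrite (le_trans (fL _ _ (inab s s01) (inab t t01))) //.
  by rewrite opprD addrACA subrr add0r -mulrBr normrM (gtr0_norm d0) mulrA.
exists (p \Po ((b - a)^-1 *: ('X - a%:P))) => t /andP[ta tb].
rewrite horner_comp !hornerE; set s := (X in p.[X]).
have st : a + (b - a) * s = t by rewrite /s; field; rewrite gt_eqF.
rewrite -[in f t]st; apply: pf.
by rewrite -(ler_pM2l d0) -(ler_pM2l d0 s) mulr0 mulr1; move: st; lra.
Qed.

End Bernstein.

(** * Real powers of real numbers *)

Section RealPowers.
Context {R : realType}.
Implicit Types (s t x y v w : R).

Lemma powR_mean_value x y v : 0 < x -> x < y ->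
  exists2 c, x < c < y & y `^ v - x `^ v = v * c `^ (v - 1) * (y - x).
Proof.
move=> x0 xy.
have der (c : R) : 0 < c -> is_derive c 1 (@powR R ^~ v) (v * c `^ (v - 1)).
  exact: is_derive1_powR.
have [c||c] := @MVT R (@powR R ^~ v) (fun c : R => v * c `^ (v - 1)) x y xy.
- by rewrite in_itv /= => /andP[xc _]; apply: der; exact: lt_trans xc.
- apply: derivable_within_continuous => c; rewrite in_itv /= => /andP[xc _].
  by have /@ex_derive := der c (lt_le_trans x0 xc).
by rewrite in_itv /= => xcy e; exists c.
Qed.

Lemma powR_le_endpoints (a b t w : R) : 0 < a -> a <= t <= b ->
  t `^ w <= a `^ w + b `^ w.
Proof.
move=> a0 /andP[at_ tb]; have t0 := lt_le_trans a0 at_; have b0 := lt_le_trans t0 tb.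
have [w0|w0] := leP 0 w.
  have : t `^ w <= b `^ w by apply: ge0_ler_powR => //; rewrite nnegrE ltW.
  by have := powR_ge0 a w; lra.
have : t `^ w <= a `^ w.
  rewrite -[w]opprK !(powRN _ (- w)) lef_pV2 ?posrE ?powR_gt0 //.
  by apply: ge0_ler_powR => //; rewrite ?nnegrE ?oppr_ge0 ltW.
by have := powR_ge0 b w; lra.
Qed.

Lemma powR_lipschitz (a b v : R) : 0 < a ->
  exists2 L, 0 <= L & forall s t, a <= s <= b -> a <= t <= b ->
    `|s `^ v - t `^ v| <= L * `|s - t|.
Proof.
move=> a0; pose L := `|v| * (a `^ (v - 1) + b `^ (v - 1)).
exists L; first by rewrite mulr_ge0 // addr_ge0 ?powR_ge0.
have main s t : a <= s -> s < t -> t <= b -> `|t `^ v - s `^ v| <= L * `|t - s|.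
  move=> as_ st tb; have [c /andP[sc ct] ->] := powR_mean_value v (lt_le_trans a0 as_) st.
  rewrite normrM ler_wpM2r // normrM ler_wpM2l // ger0_norm ?powR_ge0 //.
  by apply: powR_le_endpoints => //; lra.
move=> s t /andP[as_ sb] /andP[at_ tb].
have [st|ts|->] := ltgtP s t; first by rewrite distrC (distrC s) main.
  exact: main.
by rewrite !subrr normr0 mulr0.
Qed.

(** By the mean value theorem t^w - 1 = w c^(w - 1) (t - 1) with c between 1 and
    t, and w (c^(w - 1) - 1) has the sign of c - 1 when w is outside [0, 1]. *)
Lemma bernoulli_powR t w : 0 < t -> w < 0 \/ 1 < w -> 1 + w * (t - 1) <= t `^ w.
Proof.
move=> t0 w01.
have slope c : 0 < c -> 0 <= w * (c `^ (w - 1) - 1) * (c - 1).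
  move=> c0; have [c1|c1] := leP 1 c.
    rewrite mulr_ge0 ?subr_ge0 //; case: w01 => w1.
      rewrite mulr_le0 ?(ltW w1) // subr_le0 -[leRHS](powRr0 c) ler_powR // subr_le0.
      by rewrite ltW // (lt_trans w1).
    rewrite mulr_ge0 ?subr_ge0 ?(le_trans ler01 (ltW w1)) //.
    by rewrite -[leLHS](powRr0 c) ler_powR // subr_ge0 ltW.
  have c01 : 0 < c <= 1 by rewrite c0 ltW.
  rewrite mulr_le0 ?subr_le0 ?(ltW c1) //; case: w01 => w1.
    rewrite mulr_le0_ge0 ?(ltW w1) // subr_ge0 -[leLHS](powRr0 c) ger_powR //.
    by rewrite subr_le0 ltW // (lt_trans w1).
  rewrite mulr_ge0_le0 ?(le_trans ler01 (ltW w1)) // subr_le0.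
  by rewrite -[leRHS](powRr0 c) ger_powR // subr_ge0 ltW.
have [t1|t1|->] := ltgtP t 1; last by rewrite subrr mulr0 addr0 powR1.
- have [c /andP[tc c1]] := powR_mean_value w t0 t1; rewrite powR1 => e.
  have := slope c (lt_trans t0 tc).
  rewrite nmulr_lge0 ?subr_lt0 // => h.
  have : w * (c `^ (w - 1) - 1) * (1 - t) <= 0.
    by rewrite mulr_le0_ge0 // subr_ge0 ltW.
  lra.
- have [c /andP[c1 ct]] := powR_mean_value w ltr01 t1; rewrite powR1 => e.
  have := slope c (lt_trans ltr01 c1).
  rewrite pmulr_lge0 ?subr_gt0 // => h.
  have : 0 <= w * (c `^ (w - 1) - 1) * (t - 1).
    by rewrite mulr_ge0 // subr_ge0 ltW.
  lra.
Qed.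

End RealPowers.

(** * The scalar inequality *)

Section ScalarInequality.
Context {R : realType}.
Implicit Types (t v : R).

Lemma dyadic_telescope t n : 0 <= t ->
  \sum_(1 <= k < n.+1) 2 ^+ k.-1 *
    (1 - 2 * t `^ (1 / 2 ^+ k) + t `^ (1 / 2 ^+ k.-1)) =
  2 ^+ n - 1 + t - 2 ^+ n * t `^ (1 / 2 ^+ n).
Proof.
move=> t0; elim: n => [|n IH].
  by rewrite big_geq // expr0 divr1 powRr1 //; ring.
by rewrite big_nat_recr //= IH exprS; ring.
Qed.

(** After telescoping, this is Bernoulli's inequality for the base t^(1/2^n) and
    the exponent 2^n v. *)
Lemma weighted_mean_le_dyadic t v n : 0 < t -> v \notin `[0, 1 / 2 ^+ n] ->
  1 - v + v * t <= t `^ v + v * \sum_(1 <= k < n.+1) 2 ^+ k.-1 *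
    (1 - 2 * t `^ (1 / 2 ^+ k) + t `^ (1 / 2 ^+ k.-1)).
Proof.
move=> t0 vn; have n0 : 0 < 2 ^+ n :> R by rewrite exprn_gt0.
have w01 : v * 2 ^+ n < 0 \/ 1 < v * 2 ^+ n.
  move: vn; rewrite in_itv /= negb_and -!ltNge ltr_pdivrMr //.
  by case/orP => h; [left; rewrite pmulr_llt0|right].
have := bernoulli_powR (powR_gt0 (1 / 2 ^+ n) t0) w01.
rewrite -powRrM; have -> : 1 / 2 ^+ n * (v * 2 ^+ n) = v by field; rewrite gt_eqF.
by rewrite (dyadic_telescope n (ltW t0)); lra.
Qed.

(** Apply [weighted_mean_le_dyadic] to 1/t and 1 - v, and multiply by t. *)
Lemma weighted_mean_le_dyadic_dual t v n : 0 < t -> v \notin `[(2 ^+ n - 1) / 2 ^+ n, 1] ->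
  1 - v + v * t <= t `^ v + (1 - v) * \sum_(1 <= k < n.+1) 2 ^+ k.-1 *
    (t - 2 * t `^ ((2 ^+ k - 1) / 2 ^+ k) +
     t `^ ((2 ^+ k.-1 - 1) / 2 ^+ k.-1)).
Proof.
move=> t0 vn; have n0 k : 2 ^+ k != 0 :> R by rewrite expf_neq0.
have vn' : 1 - v \notin `[0, 1 / 2 ^+ n].
  apply: contra vn; rewrite !in_itv /= mulrBl divff // => /andP[h1 h2].
  by apply/andP; split; lra.
have tV0 : 0 < t^-1 by rewrite invr_gt0.
have pow w : t * t^-1 `^ w = t `^ (1 - w).
  rewrite -[t^-1]powR_inv1 ?ltW // -powRrM mulN1r -[X in X * _](powRr1 (ltW t0)).
  by rewrite -powRD // (gt_eqF t0) implybT.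
have := weighted_mean_le_dyadic tV0 vn'; rewrite -(ler_pM2l t0).
have -> : t * (1 - (1 - v) + (1 - v) * t^-1) = 1 - v + v * t.
  by field; rewrite gt_eqF.
rewrite [leRHS]mulrDr pow subKr [in leRHS]mulrCA mulr_sumr.
congr (_ <= _ + _ * _); apply: eq_bigr => k _; rewrite mulrCA; congr (_ * _).
by rewrite mulrDr mulrBr mulr1 [t * (2 * _)]mulrCA !pow !mulrBl !divff.
Qed.

End ScalarInequality.

(** * Powers of a positive invertible operator *)

Section OperatorPowers.
Context {R : realType} {H : hilbertType R}.
Implicit Types (S T X Z : H -> H) (v w : R).

(** Below the lower bound and above the upper bound of the quadratic form,
    T - t is coercive up to sign. *)
Lemma positive_invertible_spectrum T : positive_invertible T ->
  exists a b : R, [/\ 0 < a, a < b &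
    forall t, spectrum T t%:C -> a <= t <= b].
Proof.
move=> [/positive_operatorP[sT T0] iT].
have [c c0 Tc] := invertible_coercive sT T0 iT.
have [M M0 TM] := bounded_numerical_range (self_adjoint_bounded sT).
have sId (a : R) : self_adjoint (a%:C *: (id : H -> H)).
  by apply: self_adjoint_scale; exact: self_adjoint_id.
exists c, (M + c); split=> //; first by rewrite ltrDr.
move=> t Tt; apply/andP; split; rewrite leNgt; apply/negP => ht; apply: Tt.
  apply: (@coercive_invertible _ _ _ (c - t)).
  - exact: self_adjoint_sub.
  - by rewrite subr_gt0.
  - move=> x; rewrite !fctE rinnerBl rinnerZl rinner_sq.
    by have := Tc x; lra.
have -> : T - t%:C *: id = (-1 : R[i]) *: (id : H -> H) \o (t%:C *: id - T).
  by apply/funext => x; rewrite /= !fctE scaleN1r opprB.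
apply: invertible_comp; first by apply: invertible_scale; rewrite oppr_eq0 oner_eq0.
apply: (@coercive_invertible _ _ _ (t - M)).
- exact: self_adjoint_sub.
- by lra.
- move=> x; rewrite !fctE rinnerBl rinnerZl rinner_sq.
  by have := TM x; lra.
Qed.

Lemma opowerP T v : positive_invertible T ->
  is_functional_calculus (fun t => t `^ v) T (opower T v).
Proof.
move=> iT; have [/positive_operatorP[sT _] _] := iT.
have [a [b [a0 ab Tab]]] := positive_invertible_spectrum iT.
have [L L0 lip] := powR_lipschitz b v a0.
apply: functional_calculus_exists => // e e0.
have [p pP] := lipschitz_poly_approx e0 ab L0 lip.
by exists p => t /Tab; exact: pP.
Qed.

Lemma opower_self_adjoint T v : positive_invertible T -> self_adjoint (opower T v).
Proof.
move=> iT; have [/positive_operatorP[sT _] _] := iT.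
exact: functional_calculus_self_adjoint (opowerP v iT).
Qed.

Lemma opowerD T v w : positive_invertible T ->
  opower T v \o opower T w = opower T (v + w).
Proof.
move=> iT; have [/positive_operatorP[sT _] _] := iT.
have [a [b [a0 ab Tab]]] := positive_invertible_spectrum iT.
pose K u := a `^ u + b `^ u.
have K0 u : 0 <= K u by rewrite addr_ge0 ?powR_ge0.
have TK u t : spectrum T t%:C -> `|t `^ u| <= K u.
  by move=> /Tab tab; rewrite ger0_norm ?powR_ge0 // powR_le_endpoints.
apply: (functional_calculus_uniq sT _ _ (opowerP (v + w) iT)); last first.
  apply: (functional_calculus_mul sT (K := K v + K w)) (opowerP v iT) (opowerP w iT).
  - by move=> t /(TK v)/le_trans; apply; rewrite lerDl.
  - by move=> t /(TK w)/le_trans; apply; rewrite lerDr.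
move=> t /Tab /andP[at_ _]; rewrite powRD //.
by rewrite (gt_eqF (lt_le_trans a0 at_)) implybT.
Qed.

Lemma opower0 T : positive_invertible T -> opower T 0 = id.
Proof.
move=> iT; have [/positive_operatorP[sT _] _] := iT.
have := functional_calculus_cst sT 1; rewrite scale1r.
by apply: (functional_calculus_uniq sT _ (opowerP 0 iT)) => t _; rewrite powRr0.
Qed.

Lemma opower1 T : positive_invertible T -> opower T 1 = T.
Proof.
move=> iT; have [/positive_operatorP[sT _] _] := iT.
have [a [b [a0 ab Tab]]] := positive_invertible_spectrum iT.
apply: (functional_calculus_uniq sT _ (opowerP 1 iT) (functional_calculus_id sT)).
by move=> t /Tab /andP[at_ _]; rewrite powRr1 // (le_trans (ltW a0)).
Qed.

Lemma positive_invertible_conj X Y T : self_adjoint Y -> bounded_operator X ->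
  X \o Y = id -> Y \o X = id ->
  positive_invertible T -> positive_invertible (Y \o T \o Y).
Proof.
move=> sY bX XY YX [/positive_operatorP[sT T0] iT].
have iY : invertible_operator Y.
  by split; [exact: self_adjoint_bounded|exists X].
split; last by apply: invertible_comp => //; exact: invertible_comp.
apply/positive_operatorP; split; first exact: self_adjoint_conj.
by move=> x; rewrite /= self_adjoint_rinner.
Qed.

(** * Congruences of the functional calculus *)

(** The operators X f(T) X.  Both sides of the main inequality are of this form
    for the same X and T, and reading off f is compositional. *)
Definition congruent_calculus X T (f : R -> R) (W : H -> H) : Prop :=
  exists2 Z, is_functional_calculus f T Z & W = X \o Z \o X.

Section Congruence.
Context (X T : H -> H) (sX : self_adjoint X) (sT : self_adjoint T).
Implicit Types (f g : R -> R) (W : H -> H).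

Lemma congruent_calculus_add f g W1 W2 :
  congruent_calculus X T f W1 -> congruent_calculus X T g W2 ->
  congruent_calculus X T (fun t => f t + g t) (W1 + W2).
Proof.
move=> [Z1 fZ1 ->] [Z2 gZ2 ->].
exists (Z1 + Z2); first exact: functional_calculus_add.
by apply/funext => x; rewrite /= !fctE (linear_opD _ _ (self_adjoint_linear sX)).
Qed.

Lemma congruent_calculus_scale (a : R) f W : congruent_calculus X T f W ->
  congruent_calculus X T (fun t => a * f t) (a%:C *: W).
Proof.
move=> [Z fZ ->]; exists (a%:C *: Z); first exact: functional_calculus_scale.
by apply/funext => x; rewrite /= !fctE (linear_opZ _ _ (self_adjoint_linear sX)).
Qed.

Lemma congruent_calculus_sub f g W1 W2 :
  congruent_calculus X T f W1 -> congruent_calculus X T g W2 ->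
  congruent_calculus X T (fun t => f t - g t) (W1 - W2).
Proof.
move=> fW1 /(congruent_calculus_scale (-1)) gW2.
rewrite rmorphN1 in gW2.
have -> : W1 - W2 = W1 + -1 *: W2 by rewrite scaleN1r.
have -> : (fun t => f t - g t) = (fun t => f t + -1 * g t).
  by apply/funext => t; rewrite mulN1r.
exact: congruent_calculus_add.
Qed.

Lemma congruent_calculus_sum (m n : nat) (f : nat -> R -> R) (W : nat -> H -> H) :
  (forall k, congruent_calculus X T (f k) (W k)) ->
  congruent_calculus X T (fun t => \sum_(m <= k < n) f k t)
    (\sum_(m <= k < n) W k).
Proof.
move=> fW; rewrite /index_iota; elim: (iota _ _) => [|k s IH].
  exists 0; last first.
    rewrite big_nil; apply/funext => x /=.
    by rewrite (linear_op0 (self_adjoint_linear sX)).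
  under eq_fun do rewrite big_nil.
  by have := functional_calculus_cst sT 0; rewrite scale0r.
rewrite big_cons; under eq_fun do rewrite big_cons.
exact: congruent_calculus_add.
Qed.

(** A congruence by a self-adjoint operator preserves positivity. *)
Lemma congruent_calculus_ge0 f W :
  (forall t, spectrum T t%:C -> 0 <= f t) -> congruent_calculus X T f W ->
  positive_operator W.
Proof.
move=> f0 [Z /(functional_calculus_ge0 sT f0) /positive_operatorP[sZ Z0] ->].
apply/positive_operatorP; split; first exact: self_adjoint_conj.
by move=> x; rewrite /= self_adjoint_rinner.
Qed.

End Congruence.
End OperatorPowers.

Unset Implicit Arguments.

Theorem theorem5 (R : realType) (H : hilbertType R) (A B : H -> H)
    (hA : positive_invertible A) (hB : positive_invertible B)
    (n : nat) (hn : (1 <= n)%N) (v : R) :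
  (v \notin `[0, 1 / 2 ^+ n] ->
     A ∇_[v] B <=op
     A ♮_[v] B + v%:C *: \sum_(1 <= k < n.+1) 2 ^+ k.-1 *:
       (A - 2 *: (A ♯_[1 / 2 ^+ k] B) + A ♯_[1 / 2 ^+ k.-1] B)) /\
  (v \notin `[(2 ^+ n - 1) / 2 ^+ n, 1] ->
     A ∇_[v] B <=op
     A ♮_[v] B + (1 - v)%:C *: \sum_(1 <= k < n.+1) 2 ^+ k.-1 *:
       (B - 2 *: (A ♯_[(2 ^+ k - 1) / 2 ^+ k] B)
          + A ♯_[(2 ^+ k.-1 - 1) / 2 ^+ k.-1] B)).
Proof.
pose X := opower A 2^-1; pose Y := opower A (- 2^-1); pose C := Y \o B \o Y.
have sX : self_adjoint X by exact: opower_self_adjoint.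
have sY : self_adjoint Y by exact: opower_self_adjoint.
have XY : X \o Y = id by rewrite opowerD // subrr opower0.
have YX : Y \o X = id by rewrite opowerD // addNr opower0.
have iC : positive_invertible C.
  exact: positive_invertible_conj sY (self_adjoint_bounded sX) XY YX hB.
have [/positive_operatorP[sC _] _] := iC.
have cA : congruent_calculus X C (fun=> 1) A.
  exists id; last first.
    rewrite -[RHS]/(X \o X) opowerD // -[LHS](opower1 hA); congr opower; lra.
  by have := functional_calculus_cst sC 1; rewrite scale1r.
have cB : congruent_calculus X C (fun t => t) B.
  exists C; first exact: functional_calculus_id.
  apply/funext => x; rewrite /C /=.
  have -> : Y (X x) = x by exact: (congr1 (fun f => f x) YX).
  by have /= -> := congr1 (fun f => f (B x)) XY.
have cpow w : congruent_calculus X C (fun t => t `^ w) (A ♮_[w] B).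
  by exists (opower C w); first exact: opowerP.
have cadd := congruent_calculus_add sX sC; have csub := congruent_calculus_sub sX sC.
have cscale := congruent_calculus_scale sX sC.
have cmean : congruent_calculus X C (fun t => (1 - v) * 1 + v * t) (A ∇_[v] B).
  exact: (cadd _ _ _ _ (cscale (1 - v) _ _ cA) (cscale v _ _ cB)).
have pos t : spectrum C t%:C -> 0 < t.
  have [a [b [a0 _ Cab]]] := positive_invertible_spectrum iC.
  by move=> /Cab /andP[/(lt_le_trans a0)].
have real2 k : 2 ^+ k = (2 ^+ k)%:C :> R[i] by rewrite rmorphXn rmorph_nat.
have correction (F : R -> R) W (c d : nat -> R) : congruent_calculus X C F W ->
    congruent_calculus X C
      (fun t => \sum_(1 <= k < n.+1) 2 ^+ k.-1 * (F t - (2 * t `^ c k) + t `^ d k))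
      (\sum_(1 <= k < n.+1) 2 ^+ k.-1 *:
        (W - 2 *: (A ♮_[c k] B) + A ♮_[d k] B)).
  move=> cF; apply: (congruent_calculus_sum sX sC) => k; rewrite real2.
  apply/cscale/(cadd _ _ _ _ _ (cpow (d k)))/(csub _ _ _ _ cF).
  have -> : 2 = (2 : R)%:C :> R[i] by rewrite rmorph_nat.
  exact: cscale (cpow (c k)).
have difference (F : R -> R) W (a : R) (c d : nat -> R) cF :=
  csub _ _ _ _ (cadd _ _ _ _ (cpow v) (cscale a _ _ (correction F W c d cF))) cmean.
split=> hv.
- have D := difference _ _ v (fun k => 1 / 2 ^+ k) (fun k => 1 / 2 ^+ k.-1) cA.
  apply: (congruent_calculus_ge0 sX sC _ D) => t /pos t0.
  rewrite subr_ge0 mulr1; exact: weighted_mean_le_dyadic.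
- have D := difference _ _ (1 - v) (fun k => (2 ^+ k - 1) / 2 ^+ k)
    (fun k => (2 ^+ k.-1 - 1) / 2 ^+ k.-1) cB.
  apply: (congruent_calculus_ge0 sX sC _ D) => t /pos t0.
  rewrite subr_ge0 mulr1; exact: weighted_mean_le_dyadic_dual.
Qed.
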